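(* Let $d = 6$. Define \[ B_{\leq 6}(6) \;=\; \inf \Big\{ h(\bm I) \;:\; h \in C_{\succeq 0}(U(6)) \cap \mathbb{C}_{\leq 6}[\bm U, \overline{\bm U}] \text{ real-valued},\; h(\bm H) \leq 0 \text{ for all } \bm H \in H(6),\; \textstyle\int h \, d\nu = 1 \Big\}. \] Then $B_{\leq 6}(6) = 7$. (In words: positive definite polynomials of degree at most $6$ cannot show, via the method of positive definite functions, that there are fewer than $7$ mutually unbiased bases in $\mathbb{C}^6$.)
   Context: $U(d)$ is the group of $d\times d$ complex unitary matrices, $\bm I$ its identity, and $\nu$ its Haar probability measure. A continuous $f: G \to \mathbb{C}$ on a compact group $G$ is positive definite if for all $n \geq 1$, $g_1,\dots,g_n \in G$ and $c_1,\dots,c_n \in \mathbb{C}$, $\sum_{i,j} \overline{c_i} f(g_i^{-1} g_j) c_j \geq 0$; $C_{\succeq 0}(G)$ is the set of such functions. $\mathbb{C}_{\leq k}[\bm U, \overline{\bm U}]$ denotes the functions on $U(d)$ given by polynomials of degree at most $k$ in the entries $U_{ij}$ of $\bm U$ and their complex conjugates. $H(d) \subset U(d)$ is the set of Hadamard matrices, i.e., unitary $\bm H$ with $|H_{ij}| = 1/\sqrt{d}$ for all $i,j$. Two orthonormal bases of $\mathbb{C}^d$ are unbiased if $|\langle \bm v, \bm w\rangle| = 1/\sqrt d$ for all $\bm v$ in the first and $\bm w$ in the second; a set of orthonormal bases is mutually unbiased if any two are unbiased. *)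

(* Defs.v *)
From HB Require Import structures.
From mathcomp Require Import all_boot all_order all_algebra.
From mathcomp Require Import all_classical all_reals all_analysis.
From mathcomp.real_closed Require Import complex.
From mathcomp Require mpoly.
Import Order.TTheory GRing.Theory Num.Theory.
Import numFieldNormedType.Exports.

Set Implicit Arguments.
Unset Strict Implicit.
Unset Printing Implicit Defensive.

Local Open Scope ring_scope.
Local Open Scope classical_set_scope.

(* The complex numbers over an arbitrary model R of the reals,
   seen as a numClosedFieldType (so that it carries its norm topology). *)
Definition Cx (R : realType) : numClosedFieldType := R[i].

Definition adjmx (R : realType) (d : nat) (A : 'M[Cx R]_d) : 'M[Cx R]_d :=
  (map_mx Num.conj A)^T.

Definition unitary (R : realType) (d : nat) (U : 'M[Cx R]_d) : Prop :=
  U *m adjmx U = 1%:M.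

Definition hadamard (R : realType) (d : nat) (H : 'M[Cx R]_d) : Prop :=
  unitary H /\ forall i j, `|H i j| = (sqrtC (d%:R : Cx R))^-1.

Definition MatBorel (R : realType) (d : nat) :=
  g_sigma_algebraType (@open 'M[Cx R]_d).

Definition is_haar (R : realType) (d : nat) (nu : probability (MatBorel R d) R) : Prop :=
  nu [set U : MatBorel R d | unitary U] = 1%E /\
  forall (V : 'M[Cx R]_d), unitary V ->
    forall A : set (MatBorel R d), measurable A ->
      nu [set (V *m U : MatBorel R d) | U in A] = nu A.

(* Positive definite continuous functions on U(d) (functions are given on all
   matrices, only their values on U(d) matter). *)
Definition pos_def_on_U (R : realType) (d : nat) (f : 'M[Cx R]_d -> Cx R) : Prop :=
  {within [set U | unitary U], continuous f} /\
  forall (n : nat) (g : 'I_n -> 'M[Cx R]_d) (c : 'I_n -> Cx R),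
    (forall i, unitary (g i)) ->
    0 <= \sum_(i < n) \sum_(j < n) (c i)^* * f (invmx (g i) *m g j) * c j.

Definition entry_vars (R : realType) (d : nat) (U : 'M[Cx R]_d) :
  'I_(d * d + d * d) -> Cx R :=
  fun k => match fintype.split k with
           | inl a => mxvec U 0 a
           | inr a => (mxvec U 0 a)^*
           end.

Definition poly_le (R : realType) (d k : nat) (f : 'M[Cx R]_d -> Cx R) : Prop :=
  exists p : mpoly.mpoly (d * d + d * d) (Cx R),
    all (fun m => (mpoly.mdeg m <= k)%N) (mpoly.msupp p) /\
    forall U, unitary U -> f U = mpoly.meval (entry_vars U) p.

Definition admissible (R : realType) (d k : nat)
  (nu : probability (MatBorel R d) R) (h : 'M[Cx R]_d -> Cx R) : Prop :=
  [/\ pos_def_on_U h,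
      poly_le k h,
      (forall U, unitary U -> h U \is Num.real),
      (forall H, hadamard H -> h H <= 0) &
      ((\int[nu]_(U in [set U : MatBorel R d | unitary U]) (complex.Re (h U))%:E)%E
         = 1%E)].

Definition B_le (R : realType) (d k : nat) (nu : probability (MatBorel R d) R) : R :=
  inf [set complex.Re (h 1%:M) | h in admissible k nu].

(* Main.v *)
(* Let [F_k U = \sum_ij |U_ij|^2k], let [K] be the group of monomial matrices
   whose nonzero entries are 7th roots of unity, and let [E_V f] be the average
   of [f (k V l^* )] over [k, l] in [K].

   Upper bound: [7/5 (F_2 - 1)] is admissible with value 7 at the identity.  It is
   positive definite because [F_2 U - 1 = \sum_ij (|U_ij|^2 - 1/6)^2] and
   [|U_ij|^2 - 1/6] is the inner product of the traceless parts of two rank one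
   projections.

   Lower bound: a linear functional on the polynomials of degree at most 6 that is
   invariant under left and right multiplication by [K] is determined by its values
   at [1], [F_2] and [F_3]: the phases leave only balanced monomials, in which
   permutation invariance together with the orthonormality of rows and columns lets
   one sum out every index that occurs alone; with at most three factors this ends
   with all indices equal.  Let [H] be the Fourier matrix, [w] a primitive 6th root
   of unity and [U_v] the unitary matrix multiplying (1,...,1) by [v] and fixing its
   orthogonal complement.  Then
     [E_1 + 6 E_H - 7 \int - 9/4 \sum_(a, b < 6) (-1)^(a+b) E_(U_(w^a)^* U_(w^b))]
   kills [1], [F_2] and [F_3], hence every polynomial of degree at most 6.  For an
   admissible [h] we have [E_1 h <= h 1], [E_H h <= 0], [\int h = 1], and the last
   sum is nonnegative by positive definiteness; so [h 1 >= 7]. *)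
Require Import Defs.
From HB Require Import structures.
From mathcomp Require Import all_boot all_order all_algebra all_fingroup.
From mathcomp Require Import all_classical all_reals all_analysis.
From mathcomp Require Import measurable_realfun.
From mathcomp.real_closed Require Import complex.
From mathcomp Require Import ring zify.
From mathcomp Require mpoly.
Import (canonicals, coercions) mpoly.
Import Order.TTheory GRing.Theory Num.Theory.
Import numFieldNormedType.Exports.

Set Implicit Arguments.
Unset Strict Implicit.
Unset Printing Implicit Defensive.

Local Open Scope ring_scope.
Local Open Scope classical_set_scope.

(** * Polynomial functions on the unitary group *)

Lemma unitary_adjl (R : realType) d (U : 'M[Cx R]_d) :
  unitary U -> adjmx U *m U = 1%:M.
Proof. exact: mulmx1C. Qed.

Lemma unitary_row (R : realType) d (U : 'M[Cx R]_d) i k :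
  unitary U -> \sum_j U i j * (U k j)^* = (i == k)%:R.
Proof.
move=> /matrixP /(_ i k); rewrite !mxE => <-.
by apply: eq_bigr => j _; rewrite !mxE.
Qed.

Lemma unitary_col (R : realType) d (U : 'M[Cx R]_d) j k :
  unitary U -> \sum_i U i j * (U i k)^* = (j == k)%:R.
Proof.
move=> /unitary_adjl /matrixP /(_ k j); rewrite !mxE eq_sym => <-.
by apply: eq_bigr => i _; rewrite !mxE mulrC.
Qed.

(** An inductive class, so that continuity, boundedness on the unitary group and separation of
    variables can be proved by induction. Degrees are not recorded here; the lists in [mon] carry
    them. *)
Inductive polyf (R : realType) d : ('M[Cx R]_d -> Cx R) -> Prop :=
| polyf_cst c : polyf (fun=> c)
| polyf_coord i j : polyf (fun U => U i j)
| polyf_conj i j : polyf (fun U => (U i j)^*)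
| polyf_add f g : polyf f -> polyf g -> polyf (fun U => f U + g U)
| polyf_mul f g : polyf f -> polyf g -> polyf (fun U => f U * g U).

Section PolyfClosure.
Variables (R : realType) (d : nat).
Implicit Types f : 'M[Cx R]_d -> Cx R.

Lemma polyf_sum (I : Type) (s : seq I) (P : pred I) (F : I -> 'M[Cx R]_d -> Cx R) :
  (forall i, polyf (F i)) -> polyf (fun U => \sum_(i <- s | P i) F i U).
Proof.
move=> FP; elim: s => [|a s IH].
  by under eq_fun do rewrite big_nil; exact: polyf_cst.
under eq_fun do rewrite big_cons.
by case: (P a) => //; exact: polyf_add (FP a) IH.
Qed.

Lemma polyf_prod (I : Type) (s : seq I) (P : pred I) (F : I -> 'M[Cx R]_d -> Cx R) :
  (forall i, polyf (F i)) -> polyf (fun U => \prod_(i <- s | P i) F i U).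
Proof.
move=> FP; elim: s => [|a s IH].
  by under eq_fun do rewrite big_nil; exact: polyf_cst.
under eq_fun do rewrite big_cons.
by case: (P a) => //; exact: polyf_mul (FP a) IH.
Qed.

Lemma polyf_exp f n : polyf f -> polyf (fun U => f U ^+ n).
Proof.
move=> fP; elim: n => [|n IH]; first by under eq_fun do rewrite expr0; exact: polyf_cst.
by under eq_fun do rewrite exprS; exact: polyf_mul.
Qed.

Lemma polyf_comp d' (W : 'M[Cx R]_d' -> 'M[Cx R]_d) f :
  (forall i j, polyf (fun U => W U i j)) ->
  (forall i j, polyf (fun U => (W U i j)^*)) ->
  polyf f -> polyf (fun U => f (W U)).
Proof.
move=> W1 W2; elim=> [c|i j|i j|g h _ IHg _ IHh|g h _ IHg _ IHh] //.
- exact: polyf_cst.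
- exact: polyf_add.
- exact: polyf_mul.
Qed.

End PolyfClosure.

(** The lists serve as multisets of positions, [s] for the plain factors and [t] for the conjugated
    ones; the degree is [size s + size t]. *)
Definition mon (R : realType) d (s t : seq ('I_d * 'I_d)) (U : 'M[Cx R]_d) : Cx R :=
  \prod_(p <- s) U p.1 p.2 * \prod_(p <- t) (U p.1 p.2)^*.

Lemma polyf_mon (R : realType) d s t : polyf (@mon R d s t).
Proof.
apply: polyf_mul; apply: polyf_prod => p; [exact: polyf_coord|exact: polyf_conj].
Qed.

Definition sq (R : realType) d i j (U : 'M[Cx R]_d) : Cx R := U i j * (U i j)^*.

Lemma polyf_sq (R : realType) d i j : polyf (@sq R d i j).
Proof. by apply: polyf_mul; [exact: polyf_coord|exact: polyf_conj]. Qed.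

Definition Fpow (R : realType) d k (U : 'M[Cx R]_d) : Cx R :=
  \sum_i \sum_j sq i j U ^+ k.

Lemma polyf_Fpow (R : realType) d k : polyf (@Fpow R d k).
Proof. by do 2! apply: polyf_sum => ?; apply/polyf_exp/polyf_sq. Qed.

Definition rowact (R : realType) d (z : Cx R) (s : {perm 'I_d}) (t : 'I_d -> nat)
  (U : 'M[Cx R]_d) : 'M[Cx R]_d := \matrix_(i, j) (z ^+ t i * U (s i) j).

Definition colact (R : realType) d (z : Cx R) (s : {perm 'I_d}) (t : 'I_d -> nat)
  (U : 'M[Cx R]_d) : 'M[Cx R]_d := \matrix_(i, j) (z ^+ t j * U i (s j)).

(** Linearity and invariance are demanded on [polyf] functions only, because the Haar integral is
    additive only on integrable ones. Multiplication by monomial matrices on the left and on the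
    right enters as [rowact] and [colact]. *)
Record monomial_invariant (R : realType) d (z : Cx R)
    (L : ('M[Cx R]_d -> Cx R) -> Cx R) : Prop := MonomialInvariant {
  minv_ext : forall f g, polyf f -> polyf g ->
    (forall U, unitary U -> f U = g U) -> L f = L g;
  minv_add : forall f g, polyf f -> polyf g -> L (fun U => f U + g U) = L f + L g;
  minv_scale : forall c f, polyf f -> L (fun U => c * f U) = c * L f;
  minv_row : forall s t f, polyf f -> L (fun U => f (rowact z s t U)) = L f;
  minv_col : forall s t f, polyf f -> L (fun U => f (colact z s t U)) = L f }.

(** * Functions of indices that are invariant under permutations *)

Section PermInvariant.
Variables (C : numFieldType) (d : nat).

(** The total is the common value off [A] times the number of points off [A], and that number is
    nonzero as soon as there is such a point. *)
Lemma sum_eq0_const_off (A : seq 'I_d) (f : 'I_d -> C) :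
  (forall z z', z \notin A -> z' \notin A -> f z = f z') ->
  (forall z, z \in A -> f z = 0) -> \sum_z f z = 0 -> forall z, f z = 0.
Proof.
move=> fc fA S0 z; have [/fA//|zA] := boolP (z \in A).
move: S0; rewrite (bigID (fun y => y \in A)) /= big1 // add0r.
rewrite (eq_bigr (fun=> f z)) => [|y yA]; last exact: fc.
rewrite sumr_const => /eqP; rewrite mulrn_eq0 => /orP[/eqP c0|/eqP//].
by have := card0_eq c0 z; rewrite unfold_in zA.
Qed.

Lemma perm_inv1 (f : 'I_d -> C) :
  (forall (s : {perm 'I_d}) x, f (s x) = f x) -> \sum_x f x = 0 -> forall x, f x = 0.
Proof.
move=> finv; apply: (@sum_eq0_const_off [::]) => // x y _ _.
by rewrite -(finv (tperm x y)) tpermL.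
Qed.

(** With [x] fixed, transpositions that fix [x] show that [f x] is constant off [x], where the
    vanishing sum applies. *)
Lemma perm_inv2 (f : 'I_d -> 'I_d -> C) :
  (forall (s : {perm 'I_d}) x y, f (s x) (s y) = f x y) ->
  (forall x, \sum_y f x y = 0) -> (forall x, f x x = 0) -> forall x y, f x y = 0.
Proof.
move=> finv S0 D0 x; apply: (@sum_eq0_const_off [:: x]) => // [y y'|y].
  rewrite !inE => yx y'x; rewrite -(finv (tperm y y')) tpermL tpermD //.
by rewrite inE => /eqP->.
Qed.

(** The three ways of having two equal arguments are instances of [perm_inv2]. Otherwise
    transpositions fixing [x] and [y] make [f x y] constant off these two points. *)
Lemma perm_inv3 (f : 'I_d -> 'I_d -> 'I_d -> C) :
  (forall (s : {perm 'I_d}) x y z, f (s x) (s y) (s z) = f x y z) ->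
  (forall x y, \sum_z f x y z = 0) -> (forall x z, \sum_y f x y z = 0) ->
  (forall y z, \sum_x f x y z = 0) ->
  (forall x, f x x x = 0) -> forall x y z, f x y z = 0.
Proof.
move=> finv S3 S2 S1 D0.
have f12 x z : f x x z = 0 by apply: (@perm_inv2 (fun x z => f x x z)).
have f13 x z : f x z x = 0 by apply: (@perm_inv2 (fun x z => f x z x)).
have f23 x z : f z x x = 0 by apply: (@perm_inv2 (fun x z => f z x x)).
move=> x y; have [->//|xy] := eqVneq x y.
apply: (@sum_eq0_const_off [:: x; y]) => // [z z'|z].
  rewrite !inE !negb_or => /andP[zx zy] /andP[z'x z'y].
  by rewrite -(finv (tperm z z')) tpermL !tpermD.
by rewrite !inE => /orP[] /eqP->.
Qed.

End PermInvariant.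

Lemma not_perm_eq_count (T : eqType) (s t : seq T) :
  ~~ perm_eq s t -> exists x, count_mem x s != count_mem x t.
Proof. by rewrite /perm_eq => /allPn[x _ /= xP]; exists x. Qed.

(** Used to reorder the conjugated factors of a monomial so that they match the plain factors row by
    row. *)
Lemma perm_eq_map_lift (T1 T2 : eqType) (f : T1 -> T2) (s t : seq T1) :
  perm_eq (map f s) (map f t) -> exists2 t', perm_eq t' t & map f t' = map f s.
Proof.
case: t => [st|x0 t].
  by exists [::] => //; move/perm_nilP: st => ->.
move: (x0 :: t) => {}t st; have /(perm_iotaP (f x0))[Is IsP e] := st.
exists (map (nth x0 t) Is).
  rewrite -[X in perm_eq _ X](@mkseq_nth _ x0) /mkseq.
  by apply: perm_map; move: IsP; rewrite size_map.
rewrite e -map_comp; apply/eq_in_map => i; rewrite (perm_mem IsP) mem_iota add0n => /andP[_ il].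
by rewrite /= (nth_map x0) //; move: il; rewrite size_map.
Qed.

Lemma root7_norm (R : realType) (z : Cx R) : z ^+ 7 = 1 -> z * z^* = 1.
Proof.
move=> z7; have zz : `|z| = 1.
  by apply/eqP; rewrite -(@pexpr_eq1 _ _ 7) // -normrX z7 normr1.
by rewrite -normCK zz expr1n.
Qed.

(** * Vanishing of unbalanced monomials *)

Section PhaseVanishing.
Variables (R : realType) (d : nat) (z : Cx R).
Hypothesis z7 : z ^+ 7 = 1.
Hypothesis z1 : z != 1.
Variable L : ('M[Cx R]_d -> Cx R) -> Cx R.
Hypothesis LP : monomial_invariant z L.

Lemma root7_prim : 7.-primitive_root z.
Proof.
have [m mP m7] := prim_order_exists (isT : (0 < 7)%N) z7.
have : m \in divisors 7 by rewrite -dvdn_divisors.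
rewrite (_ : divisors 7 = [:: 1%N; 7%N]) // !inE => /orP[] /eqP mE; last by rewrite -mE.
by move: mP; rewrite mE => /prim_expr_order; rewrite expr1 => /eqP; rewrite (negbTE z1).
Qed.

Lemma root7_conj : z^* = z^-1.
Proof.
have zz := root7_norm z7; have zu : z \is a GRing.unit.
  by rewrite unitfE; apply/eqP => z0; move: zz; rewrite z0 mul0r => /eqP; rewrite eq_sym oner_eq0.
by apply: (mulrI zu); rewrite zz divrr.
Qed.

(** The reason for seventh roots of unity: in degree at most 6 the counts of plain and conjugated
    factors are below 7, so they differ modulo 7 as soon as they differ. *)
Lemma root7_phase_neq1 a b : (a < 7)%N -> (b < 7)%N -> a != b ->
  z ^+ a * (z^* ) ^+ b != 1.
Proof.
move=> a7 b7 ab; have z0 : z != 0.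
  by apply/eqP => z0; move: z7; rewrite z0 expr0n => /eqP; rewrite eq_sym oner_eq0.
rewrite root7_conj exprVn -[X in _ == X](@mulfV _ (z ^+ b)) ?expf_neq0 //.
rewrite (inj_eq (mulIf _)) ?invr_eq0 ?expf_neq0 // (eq_prim_root_expr root7_prim).
by rewrite !modn_small.
Qed.

Lemma prod_phase (I : Type) (c : Cx R) (P : pred I) (s : seq I) (F : I -> Cx R) :
  \prod_(p <- s) (c ^+ P p * F p) = c ^+ count P s * \prod_(p <- s) F p.
Proof.
elim: s => [|a s IH]; first by rewrite !big_nil mulr1.
by rewrite !big_cons IH /= exprD; ring.
Qed.

(** Multiplying the entries selected by [P] by [z] multiplies the monomial by a phase other than 1,
    while [L] does not change. Below, [P] selects one row or one column. *)
Lemma minv_phase_eq0 (P : pred ('I_d * 'I_d)) (W : 'M[Cx R]_d -> 'M[Cx R]_d) s t :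
  (forall U p, W U p.1 p.2 = z ^+ P p * U p.1 p.2) ->
  L (fun U => mon s t (W U)) = L (mon s t) ->
  (size s + size t <= 6)%N -> count P s != count P t -> L (mon s t) = 0.
Proof.
move=> WE LW st Pst; move: LW.
rewrite (_ : (fun U => _) = fun U => z ^+ count P s * (z^* ) ^+ count P t * mon s t U); last first.
  apply/funext => U; rewrite /mon.
  under eq_bigr do rewrite WE.
  under [X in _ * X = _]eq_bigr do rewrite WE rmorphM rmorphXn.
  by rewrite !(prod_phase _ P); ring.
rewrite (minv_scale LP _ (polyf_mon R s t)) => /eqP.
rewrite -subr_eq0 -{2}[L _]mul1r -mulrBl mulf_eq0 subr_eq0.
rewrite (negbTE (root7_phase_neq1 _ _ Pst)) => [/eqP//||].
  by rewrite ltnS (leq_trans (count_size _ _)) // (leq_trans _ st) // leq_addr.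
by rewrite ltnS (leq_trans (count_size _ _)) // (leq_trans _ st) // leq_addl.
Qed.

Lemma minv_mon_row_eq0 (s t : seq ('I_d * 'I_d)) : (size s + size t <= 6)%N ->
  ~~ perm_eq (map fst s) (map fst t) -> L (mon s t) = 0.
Proof.
move=> st /not_perm_eq_count[x]; rewrite !count_map.
apply: (@minv_phase_eq0 _ (rowact z 1 (fun i => i == x)) _ _ _ _ st) => [U p|].
  by rewrite mxE perm1.
exact: minv_row (polyf_mon R s t).
Qed.

Lemma minv_mon_col_eq0 (s t : seq ('I_d * 'I_d)) : (size s + size t <= 6)%N ->
  ~~ perm_eq (map snd s) (map snd t) -> L (mon s t) = 0.
Proof.
move=> st /not_perm_eq_count[x]; rewrite !count_map.
apply: (@minv_phase_eq0 _ (colact z 1 (fun i => i == x)) _ _ _ _ st) => [U p|].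
  by rewrite mxE perm1.
exact: minv_col (polyf_mon R s t).
Qed.

Lemma minv_sum (I : Type) (s : seq I) (F : I -> 'M[Cx R]_d -> Cx R) :
  (forall i, polyf (F i)) ->
  L (fun U => \sum_(i <- s) F i U) = \sum_(i <- s) L (F i).
Proof.
move=> FP; elim: s => [|a s IH].
  rewrite big_nil -[RHS](mul0r (L (fun=> 0))) -(minv_scale LP) //; last exact: polyf_cst.
  by congr L; apply/funext => U; rewrite big_nil mul0r.
rewrite big_cons -IH -(minv_add LP) //; last exact: polyf_sum.
by congr L; apply/funext => U; rewrite big_cons.
Qed.

End PhaseVanishing.

(** * Monomial-invariant functionals in degree at most 6 *)

Section LowDegreeVanishing.
Variables (R : realType) (d : nat) (z : Cx R).
Hypothesis z7 : z ^+ 7 = 1.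
Hypothesis z1 : z != 1.
Variable L : ('M[Cx R]_d -> Cx R) -> Cx R.
Hypothesis LP : monomial_invariant z L.
Hypothesis L1 : L (fun=> 1) = 0.
Hypothesis LF2 : L (@Fpow R d 2) = 0.
Hypothesis LF3 : L (@Fpow R d 3) = 0.

Lemma minv_perm_row (s : {perm 'I_d}) f : polyf f ->
  L (fun U => f (\matrix_(i, j) U (s i) j)) = L f.
Proof.
move=> fP; rewrite -[RHS](minv_row LP s (fun=> 0%N)) //; congr L.
by apply/funext => U; congr f; apply/matrixP => i j; rewrite !mxE expr0 mul1r.
Qed.

Lemma minv_perm_col (s : {perm 'I_d}) f : polyf f ->
  L (fun U => f (\matrix_(i, j) U i (s j))) = L f.
Proof.
move=> fP; rewrite -[RHS](minv_col LP s (fun=> 0%N)) //; congr L.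
by apply/funext => U; congr f; apply/matrixP => i j; rewrite !mxE expr0 mul1r.
Qed.

(** A factor running over a family whose sum is constant on the unitary group can be summed out;
    orthonormal rows and columns supply such families. *)
Lemma minv_marginal (I : Type) (r : seq I) c f (g : I -> 'M[Cx R]_d -> Cx R) :
  polyf f -> (forall y, polyf (g y)) ->
  (forall U, unitary U -> \sum_(y <- r) g y U = c) -> L f = 0 ->
  \sum_(y <- r) L (fun U => f U * g y U) = 0.
Proof.
move=> fP gP gc Lf; rewrite -(minv_sum LP) => [|y]; last exact: polyf_mul (gP y).
rewrite (minv_ext LP (g := fun U => c * f U)).
- by rewrite (minv_scale LP _ fP) Lf mulr0.
- by apply: polyf_sum => y; exact: polyf_mul (gP y).
- by apply: polyf_mul fP; exact: polyf_cst.
- by move=> U UU; rewrite -mulr_sumr gc // mulrC.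
Qed.

Lemma sum_sq_row x (U : 'M[Cx R]_d) : unitary U -> \sum_j sq x j U = 1.
Proof. by move/(unitary_row x x); rewrite eqxx. Qed.

Lemma minv_sq_exp k x y : L (@Fpow R d k) = 0 -> L (fun U => sq x y U ^+ k) = 0.
Proof.
have sP i j : polyf (fun U : 'M[Cx R]_d => sq i j U ^+ k).
  exact/polyf_exp/polyf_sq.
rewrite /Fpow (minv_sum LP) => [|i]; last exact: polyf_sum.
move=> S0; move: y; apply: perm_inv1 => [s y|].
  rewrite -(minv_perm_col s (sP x y)); congr L.
  by apply/funext => U; rewrite /sq !mxE.
move: x; apply: perm_inv1 => [s x|].
  apply: eq_bigr => y _; rewrite -(minv_perm_row s (sP x y)); congr L.
  by apply/funext => U; rewrite /sq !mxE.
by rewrite -[RHS]S0; apply: eq_bigr => x _; rewrite (minv_sum LP).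
Qed.

Lemma minv_sq1 x j : L (sq x j) = 0.
Proof.
move: j; apply: perm_inv1 => [s j|].
  rewrite -(minv_perm_col s (polyf_sq R x j)); congr L.
  by apply/funext => U; rewrite /sq !mxE.
rewrite -[RHS](@minv_marginal _ (index_enum _) 1 (fun=> 1) (sq x)) //.
- by apply: eq_bigr => j _; congr L; apply/funext => U; rewrite mul1r.
- exact: polyf_cst.
- exact: polyf_sq.
- exact: sum_sq_row.
Qed.

Lemma minv_sq2 x j k : L (fun U => sq x j U * sq x k U) = 0.
Proof.
move: j k; apply: perm_inv2 => [s j k|j|j].
- rewrite -[RHS](minv_perm_col s); last by apply: polyf_mul; exact: polyf_sq.
  by congr L; apply/funext => U; rewrite /sq !mxE.
- by apply: (minv_marginal (polyf_sq R x j) (polyf_sq R x) (sum_sq_row x)); exact: minv_sq1.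
- exact: (minv_sq_exp x j LF2).
Qed.

(** Summing over any one index leaves a product of two factors, already known to vanish. Only three
    equal indices remain, and there symmetry reduces to [LF3]. *)
Lemma minv_sq3 x j k l : L (fun U => sq x j U * sq x k U * sq x l U) = 0.
Proof.
have sum0 a b : \sum_y L (fun U => sq x a U * sq x b U * sq x y U) = 0.
  apply: (minv_marginal _ (polyf_sq R x) (sum_sq_row x)); last exact: minv_sq2.
  by apply: polyf_mul; exact: polyf_sq.
move: j k l; apply: perm_inv3 => [s j k l|//|a b|a b|j].
- rewrite -[RHS](minv_perm_col s); last first.
    by apply: (polyf_mul (f := fun U => sq x j U * sq x k U)); [apply: polyf_mul|]; exact: polyf_sq.
  by congr L; apply/funext => U; rewrite /sq !mxE.
- rewrite -[RHS](sum0 a b); apply: eq_bigr => y _; congr L.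
  by apply/funext => U; ring.
- rewrite -[RHS](sum0 a b); apply: eq_bigr => y _; congr L.
  by apply/funext => U; ring.
- rewrite -[RHS](minv_sq_exp x j LF3); congr L.
  by apply/funext => U; rewrite !exprS expr0; ring.
Qed.

(** A pair [(i, (a, b))] stands for entry (i, a) times the conjugate of entry (i, b): the monomial
    is balanced in its rows, but possibly not in its columns. *)
Definition tri (l : seq ('I_d * ('I_d * 'I_d))) (U : 'M[Cx R]_d) : Cx R :=
  \prod_(p <- l) (U p.1 p.2.1 * (U p.1 p.2.2)^*).

Lemma polyf_tri l : polyf (tri l).
Proof.
by apply: polyf_prod => p; apply: polyf_mul; [exact: polyf_coord|exact: polyf_conj].
Qed.

Lemma tri_mon l : tri l = mon (map (fun p => (p.1, p.2.1)) l) (map (fun p => (p.1, p.2.2)) l).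
Proof. by apply/funext => U; rewrite /tri /mon !big_map big_split. Qed.

(** Column phases kill the monomial unless the column indices of plain and conjugated factors agree
    as multisets. If they agree, reordering the conjugated factors gives a product of at most three
    squared moduli. *)
Lemma minv_tri_row x (l : seq ('I_d * 'I_d)) : (size l <= 3)%N ->
  L (tri (map (pair x) l)) = 0.
Proof.
move=> l3; have [pl|] := boolP (perm_eq (map fst l) (map snd l)); last first.
  rewrite tri_mon => pl; apply: (minv_mon_col_eq0 z7 z1 LP).
    by rewrite !size_map; lia.
  by rewrite -!map_comp.
have -> : tri (map (pair x) l) = fun U => \prod_(j <- map fst l) sq x j U.
  apply/funext => U; rewrite /tri big_map [RHS]big_split /= big_split /=.
  congr (_ * _); first by rewrite big_map.
  by rewrite (perm_big _ pl) /= big_map.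
case: l l3 {pl} => [|a [|b [|c [|//]]]] _ /=.
- by rewrite -[RHS]L1; congr L; apply/funext => U; rewrite big_nil.
- by rewrite -[RHS](minv_sq1 x a.1); congr L; apply/funext => U; rewrite big_seq1.
- rewrite -[RHS](minv_sq2 x a.1 b.1); congr L; apply/funext => U.
  by rewrite big_cons big_seq1.
- rewrite -[RHS](minv_sq3 x a.1 b.1 c.1); congr L; apply/funext => U.
  by rewrite !big_cons big_nil mulr1 mulrA.
Qed.

Lemma tri_perm l (s : {perm 'I_d}) :
  L (tri (map (fun p => (s p.1, p.2)) l)) = L (tri l).
Proof.
rewrite -[RHS](minv_perm_row s); last exact: polyf_tri.
congr L; apply/funext => U; rewrite /tri big_map.
by apply: eq_bigr => p _; rewrite !mxE.
Qed.

Lemma tri_marginal q l : L (tri l) = 0 -> \sum_i L (tri ((i, q) :: l)) = 0.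
Proof.
move=> Ll; pose g i (U : 'M[Cx R]_d) := U i q.1 * (U i q.2)^*.
rewrite -[RHS](@minv_marginal _ (index_enum _) (q.1 == q.2)%:R (tri l) g) //.
- by apply: eq_bigr => i _; congr L; apply/funext => U; rewrite /tri big_cons mulrC.
- exact: polyf_tri.
- by move=> y; apply: polyf_mul; [exact: polyf_coord|exact: polyf_conj].
- by move=> U; apply: unitary_col.
Qed.

Lemma tri_eq l l' : perm_eq l l' -> tri l = tri l'.
Proof. by move=> pl; apply/funext => U; apply: perm_big. Qed.

(** The row indices are treated by [perm_inv1], [perm_inv2] and [perm_inv3]: summing out a row
    leaves a shorter [tri] because columns are orthonormal, and equal rows are the case of
    [minv_tri_row]. *)
Lemma minv_tri l : (size l <= 3)%N -> L (tri l) = 0.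
Proof.
have T0 : L (tri [::]) = 0.
  by rewrite -[RHS]L1; congr L; apply/funext => U; rewrite /tri big_nil.
have T1 i p : L (tri [:: (i, p)]) = 0.
  move: i; apply: perm_inv1 => [s i|]; last exact: tri_marginal.
  by rewrite -[RHS](tri_perm _ s).
have T2 i p j q : L (tri [:: (i, p); (j, q)]) = 0.
  move: i j; apply: perm_inv2 => [s i j|i|i].
  - by rewrite -[RHS](tri_perm _ s).
  - under eq_bigr do rewrite (tri_eq (permEl (perm_catC [:: _] [:: _]))).
    exact: tri_marginal.
  - exact: (@minv_tri_row i [:: p; q]).
case: l => [|[i p] [|[j q] [|[k r] [|//]]]] // _.
move: i j k; apply: perm_inv3 => [s i j k|i j|i k|j k|i].
- by rewrite -[RHS](tri_perm _ s).
- under eq_bigr do rewrite (tri_eq (permEl (perm_catC [:: _; _] [:: _]))).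
  exact: (tri_marginal r (T2 i p j q)).
- under eq_bigr do rewrite (tri_eq (permEl (perm_catCA [:: _] [:: _] [:: _]))).
  exact: (tri_marginal q (T2 i p k r)).
- exact: (tri_marginal p (T2 j q k r)).
- exact: (@minv_tri_row i [:: p; q; r]).
Qed.

(** Row phases leave only monomials whose plain and conjugated rows agree as multisets. Matching the
    factors by row gives a [tri], with at most three factors since the two lists then have equal
    length. *)
Lemma minv_mon_eq0 s t : (size s + size t <= 6)%N -> L (mon s t) = 0.
Proof.
move=> st; have [|/(minv_mon_row_eq0 z7 z1 LP)] := boolP (perm_eq (map fst s) (map fst t)); last exact.
move/perm_eq_map_lift => [t' tt' ft'].
have -> : @mon R d s t = mon s t'.
  by apply/funext => U; rewrite /mon (perm_big _ tt').
have ss : size t' = size s by rewrite -(size_map fst t') ft' size_map.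
have -> : @mon R d s t' = tri (map (fun p => (p.1.1, (p.1.2, p.2.2))) (zip s t')).
  rewrite tri_mon -!map_comp; congr mon.
    by rewrite -[LHS](@unzip1_zip _ _ s t') ?ss //; apply: eq_map => -[[? ?] [? ?]].
  elim: s t' ft' {ss tt' st} => [|[a b] s IH] [|[a' b'] t'] //= [-> e].
  by congr cons; apply: IH.
apply: minv_tri; rewrite size_map size_zip ss minnn.
by move: st; rewrite -(perm_size tt') ss; lia.
Qed.

End LowDegreeVanishing.

(** * Averages over the monomial group *)

Lemma unitaryM (R : realType) d (U V : 'M[Cx R]_d) :
  unitary U -> unitary V -> unitary (U *m V).
Proof.
rewrite /unitary /adjmx map_mxM trmx_mul => UU VV.
by rewrite mulmxA -(mulmxA U) VV mulmx1.
Qed.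

Lemma adjmxK (R : realType) d (U : 'M[Cx R]_d) : adjmx (adjmx U) = U.
Proof. by apply/matrixP => i j; rewrite !mxE conjCK. Qed.

Lemma adjmxM (R : realType) d (U V : 'M[Cx R]_d) :
  adjmx (U *m V) = adjmx V *m adjmx U.
Proof. by rewrite /adjmx map_mxM trmx_mul. Qed.

Lemma unitary_adj (R : realType) d (U : 'M[Cx R]_d) : unitary U -> unitary (adjmx U).
Proof. by rewrite /unitary adjmxK => /unitary_adjl. Qed.

Lemma adjmx1 (R : realType) d : adjmx (1%:M : 'M[Cx R]_d) = 1%:M.
Proof. by rewrite /adjmx map_mx1 trmx1. Qed.

Lemma unitary1 (R : realType) d : unitary (1%:M : 'M[Cx R]_d).
Proof. by rewrite /unitary adjmx1 mulmx1. Qed.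

Lemma unitary_inv (R : realType) d (U : 'M[Cx R]_d) : unitary U -> invmx U = adjmx U.
Proof.
move=> UU; have Uu : U \in unitmx by case/mulmx1_unit: UU.
by rewrite -[LHS]mulmx1 -UU mulmxA mulVmx // mul1mx.
Qed.

Section MonomialInvariantLinear.
Variables (R : realType) (d : nat) (z : Cx R).

Lemma minv_lin (a b : Cx R) (L1 L2 : ('M[Cx R]_d -> Cx R) -> Cx R) :
  monomial_invariant z L1 -> monomial_invariant z L2 ->
  monomial_invariant z (fun f => a * L1 f + b * L2 f).
Proof.
move=> P1 P2; split => [f g fP gP fg|f g fP gP|c f fP|s t f fP|s t f fP].
- by rewrite (minv_ext P1 fP gP fg) (minv_ext P2 fP gP fg).
- by rewrite (minv_add P1 fP gP) (minv_add P2 fP gP); ring.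
- by rewrite (minv_scale P1 c fP) (minv_scale P2 c fP); ring.
- by rewrite (minv_row P1 s t fP) (minv_row P2 s t fP).
- by rewrite (minv_col P1 s t fP) (minv_col P2 s t fP).
Qed.

Lemma minv_zero : monomial_invariant z (fun _ : 'M[Cx R]_d -> Cx R => 0).
Proof. by split => //= *; rewrite ?addr0 ?mulr0. Qed.

Lemma minv_lin_sum (I : Type) (r : seq I) (a : I -> Cx R)
    (L : I -> ('M[Cx R]_d -> Cx R) -> Cx R) :
  (forall i, monomial_invariant z (L i)) ->
  monomial_invariant z (fun f => \sum_(i <- r) a i * L i f).
Proof.
move=> LP; elim: r => [|x r IH].
  by under eq_fun do rewrite big_nil; exact: minv_zero.
under eq_fun do rewrite big_cons -[X in _ + X]mul1r.
exact: minv_lin.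
Qed.

End MonomialInvariantLinear.

(** A finite index set for averages, made of permutations and phase exponents. No group law on the
    pairs is used; [kshift] does the work of translation. *)
Definition kgroup d : finType := ({perm 'I_d} * {ffun 'I_d -> 'Z_7})%type.

Definition kmx (R : realType) d (z : Cx R) (k : kgroup d) : 'M[Cx R]_d :=
  \matrix_(i, j) (z ^+ (k.2 i : nat) * (k.1 i == j)%:R).

Definition biavg (R : realType) d (z : Cx R) (U0 : 'M[Cx R]_d) (f : 'M[Cx R]_d -> Cx R) : Cx R :=
  (#|kgroup d|%:R ^- 2) *
  \sum_(k : kgroup d) \sum_(l : kgroup d) f (kmx z k *m U0 *m adjmx (kmx z l)).

Lemma kgroup_gt0 d : (0 < #|kgroup d|)%N.
Proof. by apply/card_gt0P; exists (1%g, [ffun=> 0]). Qed.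

Section Biavg.
Variables (R : realType) (d : nat) (z : Cx R).
Hypothesis z7 : z ^+ 7 = 1.

Lemma kmx_mulE k (X : 'M[Cx R]_d) i j :
  (kmx z k *m X) i j = z ^+ (k.2 i : nat) * X (k.1 i) j.
Proof.
rewrite mxE (bigD1 (k.1 i)) //= big1 ?addr0 => [|l ki]; rewrite mxE.
  by rewrite eqxx mulr1.
by rewrite eq_sym (negbTE ki) mulr0 mul0r.
Qed.

Lemma mul_kmxE k (X : 'M[Cx R]_d) i j :
  (X *m adjmx (kmx z k)) i j = z^* ^+ (k.2 j : nat) * X i (k.1 j).
Proof.
rewrite mxE (bigD1 (k.1 j)) //= big1 ?addr0 => [|l kj]; rewrite !mxE rmorphM rmorphXn rmorph_nat.
  by rewrite eqxx mulr1 mulrC.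
by rewrite eq_sym (negbTE kj) !mulr0.
Qed.

Lemma unitary_kmx k : unitary (@kmx R d z k).
Proof.
apply/matrixP => i j; rewrite mul_kmxE !mxE (inj_eq perm_inj).
have [->|_] := eqVneq; last by rewrite !mulr0.
by rewrite mulr1 -exprMn mulrC (root7_norm z7) expr1n.
Qed.

Lemma unitary_kmx_conj U k l : unitary U -> unitary (kmx z k *m U *m adjmx (@kmx R d z l)).
Proof.
move=> UU; apply: unitaryM; last exact/unitary_adj/unitary_kmx.
by apply: unitaryM => //; exact: unitary_kmx.
Qed.

(** The index of the product of the monomial matrix given by [s] and [t] with the one of index [k].
    Being injective on a finite type, it reindexes averages. *)
Definition kshift (s : {perm 'I_d}) (t : 'I_d -> nat) (k : kgroup d) : kgroup d :=
  ((s * k.1)%g, [ffun i => inZp (t i) + k.2 (s i)]).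

Lemma kshift_inj s t : injective (kshift s t).
Proof.
move=> [k1 k2] [l1 l2] [] /mulgI -> /ffunP e; congr pair; apply/ffunP => i.
by have := e ((s^-1)%g i); rewrite !ffunE permKV => /addrI.
Qed.

Lemma kshift_exp (w : Cx R) s t k i : w ^+ 7 = 1 ->
  w ^+ ((kshift s t k).2 i : nat) = w ^+ t i * w ^+ (k.2 (s i) : nat).
Proof.
move=> w7; rewrite ffunE /= (expr_mod _ w7) exprD; congr (_ * _).
by rewrite (expr_mod _ w7).
Qed.

Lemma rowact_kmx s t k l (U : 'M[Cx R]_d) :
  rowact z s t (kmx z k *m U *m adjmx (kmx z l)) =
  kmx z (kshift s t k) *m U *m adjmx (kmx z l).
Proof.
rewrite -!mulmxA; apply/matrixP => i j.
by rewrite mxE !kmx_mulE kshift_exp // permM mulrA.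
Qed.

(** On the right the phases enter conjugated, and the sixth power of the conjugate of [z] is [z];
    hence the factor 6 in the exponents. *)
Lemma colact_kmx s t k l (U : 'M[Cx R]_d) :
  colact z s t (kmx z k *m U *m adjmx (kmx z l)) =
  kmx z k *m U *m adjmx (kmx z (kshift s (fun i => 6 * t i)%N l)).
Proof.
apply/matrixP => i j.
rewrite mxE !mul_kmxE kshift_exp; last by rewrite -rmorphXn z7 rmorph1.
rewrite permM [LHS]mulrA exprM; congr (_ * _ * _); congr (_ ^+ _).
have z0 : z \is a GRing.unit.
  rewrite unitfE; apply/eqP => z0.
  by have := root7_norm z7; rewrite z0 mul0r => /eqP; rewrite eq_sym oner_eq0.
apply: (mulrI (_ : z ^+ 6 \is a GRing.unit)); first exact: unitrX.
by rewrite -exprSr z7 -exprMn (root7_norm z7) expr1n.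
Qed.

Lemma biavg_minv (U : 'M[Cx R]_d) : unitary U -> monomial_invariant z (biavg z U).
Proof.
move=> UU; split => [f g fP gP fg|f g fP gP|c f fP|s t f fP|s t f fP]; rewrite /biavg.
- congr (_ * _); do 2! apply: eq_bigr => ? _; apply: fg; exact: unitary_kmx_conj.
- by rewrite -mulrDr -big_split; congr (_ * _); apply: eq_bigr => k _; rewrite -big_split.
- rewrite mulrCA; congr (_ * _); rewrite mulr_sumr; apply: eq_bigr => k _.
  by rewrite mulr_sumr.
- congr (_ * _); rewrite [RHS](reindex_inj (@kshift_inj s t)) /=.
  by do 2! apply: eq_bigr => ? _; rewrite rowact_kmx.
- congr (_ * _); apply: eq_bigr => k _.
  rewrite [RHS](reindex_inj (@kshift_inj s (fun i => 6 * t i)%N)) /=.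
  by apply: eq_bigr => ? _; rewrite colact_kmx.
Qed.

Lemma biavg_const U f c : (forall k l, f (kmx z k *m U *m adjmx (@kmx R d z l)) = c) ->
  biavg z U f = c.
Proof.
move=> fc; rewrite /biavg (eq_bigr (fun=> \sum_(l : kgroup d) c)) => [|k _]; last first.
  by apply: eq_bigr => l _; exact: fc.
rewrite !sumr_const -mulrnA mulnn -[c *+ _]mulr_natr natrX mulrCA mulVf ?mulr1 //.
by rewrite expf_neq0 // pnatr_eq0 -lt0n kgroup_gt0.
Qed.

Lemma biavg_cst U c : @biavg R d z U (fun=> c) = c.
Proof. exact: biavg_const. Qed.

Lemma Fpow_kmx U n k l : Fpow n (kmx z k *m U *m adjmx (@kmx R d z l)) = Fpow n U.
Proof.
rewrite /Fpow [RHS](reindex_inj (@perm_inj _ k.1)) /=; apply: eq_bigr => i _.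
rewrite [RHS](reindex_inj (@perm_inj _ l.1)) /=; apply: eq_bigr => j _.
congr (_ ^+ _); rewrite /sq mul_kmxE kmx_mulE !rmorphM !rmorphXn /= conjCK.
rewrite (_ : _ * _ = (z * z^* ) ^+ (k.2 i : nat) * (z * z^* ) ^+ (l.2 j : nat) *
   (U (k.1 i) (l.1 j) * (U (k.1 i) (l.1 j))^*)).
  by rewrite (root7_norm z7) !expr1n !mul1r.
by rewrite !exprMn; ring.
Qed.

Lemma biavg_Fpow U n : @biavg R d z U (Fpow n) = Fpow n U.
Proof. by apply: biavg_const => k l; exact: Fpow_kmx. Qed.

Lemma pos_def_fin (I : finType) (f : 'M[Cx R]_d -> Cx R) (g : I -> 'M[Cx R]_d) (c : I -> Cx R) :
  pos_def_on_U f -> (forall i, unitary (g i)) ->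
  0 <= \sum_i \sum_j (c i)^* * f (invmx (g i) *m g j) * c j.
Proof.
move=> [_ /(_ #|I| (fun i => g (enum_val i)) (fun i => c (enum_val i)))] fP gU.
have := fP (fun i => gU _); congr (_ <= _).
rewrite [RHS](reindex_onto _ _ (fun i _ => enum_rankK i)) /=.
rewrite [RHS](eq_bigl xpredT) => [|i]; last by rewrite enum_valK eqxx.
apply: eq_bigr => i _.
rewrite [RHS](reindex_onto _ _ (fun i _ => enum_rankK i)) /=.
by rewrite [RHS](eq_bigl xpredT) // => j; rewrite enum_valK eqxx.
Qed.

(** Positive definiteness of [f] is applied to all [g i *m adjmx (kmx z k)] at once, with
    coefficients [c i] that do not depend on [k]. The inverse of one member times another is a
    matrix averaged in [biavg]. *)
Lemma biavg_posdef (I : finType) f (g : I -> 'M[Cx R]_d) (c : I -> Cx R) :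
  pos_def_on_U f -> (forall i, unitary (g i)) ->
  0 <= \sum_i \sum_j (c i)^* * biavg z (adjmx (g i) *m g j) f * c j.
Proof.
move=> fP gU.
have kU (p : I * kgroup d) : unitary (g p.1 *m adjmx (kmx z p.2)).
  by apply: unitaryM => //; exact/unitary_adj/unitary_kmx.
have := pos_def_fin (fun p => c p.1) fP kU.
rewrite -(pmulr_rge0 _ (_ : 0 < #|kgroup d|%:R ^- 2 :> Cx R)); last first.
  by rewrite invr_gt0 exprn_gt0 // ltr0n kgroup_gt0.
congr (_ <= _).
rewrite -(pair_big xpredT xpredT (fun i k => \sum_j (c i)^* *
  f (invmx (g i *m adjmx (kmx z k)) *m (g j.1 *m adjmx (kmx z j.2))) * c j.1)) /=.
rewrite mulr_sumr; apply: eq_bigr => i _.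
under eq_bigr => k _.
  rewrite -(pair_big xpredT xpredT (fun j l => (c i)^* *
    f (invmx (g i *m adjmx (kmx z k)) *m (g j *m adjmx (kmx z l))) * c j)) /=; over.
rewrite exchange_big mulr_sumr; apply: eq_bigr => j _ /=.
rewrite /biavg mulrCA -!mulrA; congr (_ * _).
rewrite mulr_suml mulr_sumr; apply: eq_bigr => k _.
rewrite mulr_suml mulr_sumr; apply: eq_bigr => l _.
rewrite mulrA; congr (_ * f _ * _).
rewrite unitary_inv; last exact: (kU (i, k)).
by rewrite adjmxM adjmxK !mulmxA.
Qed.

(** Positive definiteness at the points 1 and [g] with coefficients 1 and -1 bounds
    [f g + f (adjmx g)] by [2 * f 1%:M]. In the average over [k] and [l], taking adjoints exchanges
    the two indices, so both terms have the same mean. *)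
Lemma biavg1_le f : pos_def_on_U f -> @biavg R d z 1%:M f <= f 1%:M.
Proof.
move=> fP.
have two g : unitary g -> 0 <= 2 * f 1%:M - (f g + f (adjmx g)).
  move=> gU; have := pos_def_fin (fun b : bool => if b then 1 else -1 : Cx R) fP
    (fun b : bool => if b as b' return unitary (if b' then 1%:M else g)
                     then @unitary1 R d else gU).
  rewrite !big_bool /= (unitary_inv gU) (unitary_inv (@unitary1 R d)).
  rewrite (unitary_adjl gU) adjmx1 !mul1mx mulmx1.
  by rewrite rmorph1 rmorphN rmorph1; congr (_ <= _); ring.
have : 0 <= \sum_(k : kgroup d) \sum_(l : kgroup d)
    (2 * f 1%:M - (f (kmx z k *m 1%:M *m adjmx (kmx z l)) + f (kmx z l *m 1%:M *m adjmx (kmx z k)))).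
  apply: sumr_ge0 => k _; apply: sumr_ge0 => l _.
  have := two (kmx z k *m 1%:M *m adjmx (kmx z l)) (unitary_kmx_conj _ _ (@unitary1 R d)).
  by rewrite !adjmxM adjmxK adjmx1 !mulmx1 mul1mx.
under eq_bigr do rewrite sumrB big_split.
rewrite sumrB big_split /= [X in _ - (_ + X)]exchange_big /= -mulr2n.
rewrite !sumr_const -mulrnA mulnn subr_ge0 => H.
rewrite /biavg ler_pdivrMl; last by rewrite exprn_gt0 // ltr0n kgroup_gt0.
rewrite -(ler_pMn2r (isT : (0 < 2)%N)); move: H; congr (_ <= _).
by rewrite -[LHS]mulr_natl natrX; ring.
Qed.

End Biavg.

(** * The Haar integral of polynomial functions *)

Section ComplexTopology.
Variable R : realType.

Lemma Re_continuous : continuous (@complex.Re R : Cx R -> R).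
Proof.
move=> x; have FF : Filter (nbhs x) by exact: nbhs_filter.
apply/(cvgrPdist_lt (FF := FF)) => e e0.
have e0' : (0 : Cx R) < (e%:C)%C by rewrite ltcR.
near=> y; have : `|x - y| < (e%:C)%C by near: y; exact: cvgr_dist_lt.
rewrite normc_def ltcR; apply: le_lt_trans.
rewrite -sqrtr_sqr ler_wsqrtr //.
by case: (x) (y) => [a b] [a' b'] /=; rewrite lerDl sqr_ge0.
Unshelve. all: by end_near. Qed.

Lemma conj_continuous : continuous (Num.conj : Cx R -> Cx R).
Proof.
move=> x; have FF : Filter (nbhs x) by exact: nbhs_filter.
apply/(cvgrPdist_lt (FF := FF)) => e e0.
by near=> y; rewrite -rmorphB norm_conjC; near: y; exact: cvgr_dist_lt.
Unshelve. all: by end_near. Qed.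

Lemma Im_continuous : continuous (@complex.Im R : Cx R -> R).
Proof.
have -> : @complex.Im R = fun x : Cx R => complex.Re (x * (0 -i* 1)%C).
  by apply/funext => -[a b] /=; rewrite mulr0 sub0r mulrN1 opprK.
move=> x; apply: (@continuous_comp _ _ _ (fun x : Cx R => x * (0 -i* 1)%C) (@complex.Re R)).
  exact: mulrr_continuous.
exact: Re_continuous.
Qed.

Lemma polyf_continuous d (f : 'M[Cx R]_d -> Cx R) : polyf f -> continuous f.
Proof.
elim=> [c|i j|i j|g h _ IHg _ IHh|g h _ IHg _ IHh] x.
- exact: cst_continuous.
- exact: coord_continuous.
- apply: (@continuous_comp _ _ _ (fun U : 'M[Cx R]_d => U i j)).
    exact: coord_continuous.
  exact: conj_continuous.
- by apply: continuousD; [exact: IHg|exact: IHh].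
- by apply: continuousM; [exact: IHg|exact: IHh].
Qed.

Lemma unitary_entry_le1 d (U : 'M[Cx R]_d) i j : unitary U -> `|U i j| <= 1.
Proof.
move=> UU; rewrite -(@expr_le1 _ 2) // normCK.
rewrite -[leRHS](_ : \sum_k U i k * (U i k)^* = 1); last by rewrite unitary_row ?eqxx.
by rewrite (bigD1 j) //= lerDl sumr_ge0 // => k _; exact: mul_conjC_ge0.
Qed.

Lemma polyf_bounded d (f : 'M[Cx R]_d -> Cx R) : polyf f ->
  exists M : R, forall U, unitary U -> `|f U| <= (M%:C)%C.
Proof.
elim=> [c|i j|i j|g h _ [a aP] _ [b bP]|g h _ [a aP] _ [b bP]].
- by exists (Num.sqrt ((complex.Re c)^+2 + (complex.Im c)^+2)) => U _; rewrite normc_def.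
- by exists 1 => U UU; exact: unitary_entry_le1.
- by exists 1 => U UU; rewrite norm_conjC; exact: unitary_entry_le1.
- exists (a + b) => U UU; rewrite rmorphD; apply: (le_trans (ler_normD _ _)).
  by apply: lerD; [exact: aP|exact: bP].
- exists (a * b) => U UU; rewrite rmorphM normrM.
  by apply: ler_pM => //; [exact: aP|exact: bP].
Qed.

End ComplexTopology.

Section HaarIntegral.
Variables (R : realType) (d : nat) (nu : probability (MatBorel R d) R).
Hypothesis nuP : is_haar nu.

Definition unitary_set : set (MatBorel R d) := [set U | unitary U].

Lemma nu_unitary_set : nu unitary_set = 1%E.
Proof. exact: nuP.1. Qed.

Lemma open_MatBorel (A : set 'M[Cx R]_d) : open A -> measurable (A : set (MatBorel R d)).
Proof. by move=> oA; exact: sub_sigma_algebra. Qed.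

Lemma measurable_unitary_set : measurable unitary_set.
Proof.
rewrite -[unitary_set]setCK; apply: measurableC; apply: open_MatBorel.
rewrite openC.
have -> : unitary_set = \bigcap_(p in [set: 'I_d * 'I_d])
   ((fun U : 'M[Cx R]_d => \sum_j U p.1 j * (U p.2 j)^* ) @^-1` [set (p.1 == p.2)%:R]).
  apply/seteqP; split => U.
    by move=> UU p _; exact: unitary_row.
  move=> UU; apply/matrixP => i j; rewrite !mxE -(UU (i, j) I) /=.
  by apply: eq_bigr => k _; rewrite !mxE.
apply: closed_bigI => p _; apply: preimage_closed => [U _|]; last first.
  exact/accessible_closed_set1/hausdorff_accessible/norm_hausdorff.
apply: polyf_continuous; apply: polyf_sum => j.
by apply: polyf_mul; [exact: polyf_coord|exact: polyf_conj].
Qed.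

Lemma continuous_MatBorel (f : 'M[Cx R]_d -> R) (D : set (MatBorel R d)) :
  continuous f -> measurable_fun D (f : MatBorel R d -> R).
Proof.
move=> /continuousP cf; apply: measurable_funTS.
apply: (measurability _ (RGenOpens.measurableE R)).
move=> _ [_ [a [b ->]] <-]; rewrite setTI; apply: open_MatBorel; apply: cf; exact: interval_open.
Qed.

Lemma continuous_mx (W : 'M[Cx R]_d -> 'M[Cx R]_d) :
  (forall i j, continuous (fun U => W U i j)) -> continuous W.
Proof.
move=> cW U A [P PU PA]; have FF : Filter (nbhs U) by exact: nbhs_filter.
have : nbhs U (fun X => forall p : 'I_d * 'I_d, P p.1 p.2 (W X p.1 p.2)).
  apply: (@filter_forall _ _ (fun p X => P p.1 p.2 (W X p.1 p.2)) _ FF) => -[i j].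
  by apply: cW; exact: PU.
by apply: filterS => X PX; apply: PA => i j; exact: (PX (i, j)).
Qed.

Lemma polyf_mulmxl (V : 'M[Cx R]_d) i j : polyf (fun U => (V *m U) i j).
Proof.
under eq_fun do rewrite mxE; apply: polyf_sum => k.
by apply: polyf_mul; [exact: polyf_cst|exact: polyf_coord].
Qed.

Lemma polyf_mulmxl_conj (V : 'M[Cx R]_d) i j : polyf (fun U => ((V *m U) i j)^*).
Proof.
under eq_fun do rewrite mxE rmorph_sum; apply: polyf_sum => k /=.
under eq_fun do rewrite rmorphM.
by apply: polyf_mul; [exact: polyf_cst|exact: polyf_conj].
Qed.

Lemma polyf_comp_mull (V : 'M[Cx R]_d) f : polyf f -> polyf (fun U => f (V *m U)).
Proof. exact/polyf_comp/polyf_mulmxl_conj/polyf_mulmxl. Qed.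

Lemma measurable_mulmx (V : 'M[Cx R]_d) :
  measurable_fun setT ((fun U => V *m U) : MatBorel R d -> MatBorel R d).
Proof.
apply: (@measurability _ _ (MatBorel R d) (MatBorel R d) setT _ (@open 'M[Cx R]_d)) => //.
move=> _ [A oA <-].
rewrite setTI; apply: open_MatBorel.
have /continuousP : continuous (fun U : 'M[Cx R]_d => V *m U); last exact.
by apply: continuous_mx => i j; apply/polyf_continuous/polyf_mulmxl.
Qed.

Lemma integrable_unitary (g : 'M[Cx R]_d -> R) (M : R) : continuous g ->
  (forall U, unitary U -> `|g U| <= M) -> nu.-integrable unitary_set (EFin \o g).
Proof.
move=> cg gM; apply: measurable_bounded_integrable.
- exact: measurable_unitary_set.
- rewrite [X in (X < _)%E](_ : _ = 1%E) ?ltry //; exact: nu_unitary_set.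
- exact: continuous_MatBorel.
- exists M; split; first exact: num_real.
  by move=> y My U UU /=; apply: le_trans (ltW My); exact: gM.
Qed.

(** [is_haar] speaks of images under [V], whereas a change of variables needs preimages; the
    preimage under [V] is the image under [adjmx V]. *)
Lemma Rintegral_mulmx (V : 'M[Cx R]_d) (g : 'M[Cx R]_d -> R) (M : R) : unitary V ->
  continuous g -> (forall U, unitary U -> `|g U| <= M) ->
  Rintegral nu unitary_set (fun U => g (V *m U)) = Rintegral nu unitary_set g.
Proof.
move=> VU cg gM; have mV := measurable_mulmx V.
have UV : (fun U : MatBorel R d => V *m U : MatBorel R d) @^-1` unitary_set = unitary_set.
  apply/seteqP; split => U /=; last exact: unitaryM.
  move=> /(unitaryM (unitary_adj VU)); by rewrite mulmxA (unitary_adjl VU) mul1mx.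
rewrite /Rintegral; congr fine.
have cgV : continuous (fun U => g (V *m U)).
  move=> U; apply: (@continuous_comp _ _ _ (fun U => V *m U) g); last exact: cg.
  by apply: continuous_mx => i j; apply/polyf_continuous/polyf_mulmxl.
have := @integral_pushforward _ _ _ _ _ _ mV nu unitary_set (EFin \o g).
rewrite UV => <-.
- apply: eq_measure_integral => A mA _; rewrite -[RHS](nuP.2 _ (unitary_adj VU) A mA).
  rewrite /pushforward; congr (nu _); apply/seteqP; split => U /=.
    move=> VUA; exists (V *m U) => //.
    by rewrite mulmxA (unitary_adjl VU) mul1mx.
  by move=> [W WA <-]; rewrite mulmxA VU mul1mx.
- by apply/measurable_EFinP; exact: continuous_MatBorel.
- apply: (@integrable_unitary (fun U => g (V *m U)) M cgV) => U UU.
  by apply: gM; exact: unitaryM.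
- exact: measurable_unitary_set.
Qed.

Definition cint (f : 'M[Cx R]_d -> Cx R) : Cx R :=
  (Rintegral nu unitary_set (fun U => complex.Re (f U)) +i*
   Rintegral nu unitary_set (fun U => complex.Im (f U)))%C.

Lemma Re_norm_le (x : Cx R) (M : R) : `|x| <= (M%:C)%C -> `|complex.Re x| <= M.
Proof.
rewrite normc_def lecR; apply: le_trans; rewrite -sqrtr_sqr ler_wsqrtr //.
by rewrite lerDl sqr_ge0.
Qed.

Lemma Im_norm_le (x : Cx R) (M : R) : `|x| <= (M%:C)%C -> `|complex.Im x| <= M.
Proof.
rewrite normc_def lecR; apply: le_trans; rewrite -sqrtr_sqr ler_wsqrtr //.
by rewrite lerDr sqr_ge0.
Qed.

Lemma polyf_Re_continuous f : polyf f -> continuous (fun U : 'M[Cx R]_d => complex.Re (f U)).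
Proof.
move=> fP U; apply: (@continuous_comp _ _ _ f (@complex.Re R)).
  exact: polyf_continuous.
exact: Re_continuous.
Qed.

Lemma polyf_Im_continuous f : polyf f -> continuous (fun U : 'M[Cx R]_d => complex.Im (f U)).
Proof.
move=> fP U; apply: (@continuous_comp _ _ _ f (@complex.Im R)).
  exact: polyf_continuous.
exact: Im_continuous.
Qed.

Lemma polyf_Re_integrable f : polyf f ->
  nu.-integrable unitary_set (EFin \o (fun U : 'M[Cx R]_d => complex.Re (f U))).
Proof.
move=> fP; have [M MP] := polyf_bounded fP.
apply: (@integrable_unitary _ M); first exact: polyf_Re_continuous.
by move=> U UU; apply: Re_norm_le; exact: MP.
Qed.

Lemma polyf_Im_integrable f : polyf f ->
  nu.-integrable unitary_set (EFin \o (fun U : 'M[Cx R]_d => complex.Im (f U))).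
Proof.
move=> fP; have [M MP] := polyf_bounded fP.
apply: (@integrable_unitary _ M); first exact: polyf_Im_continuous.
by move=> U UU; apply: Im_norm_le; exact: MP.
Qed.

Lemma cint_ext f g : (forall U, unitary U -> f U = g U) -> cint f = cint g.
Proof.
by move=> fg; congr Complex; apply: eq_Rintegral => U; rewrite inE => UU; rewrite fg.
Qed.

Lemma cint_add f g : polyf f -> polyf g -> cint (fun U => f U + g U) = cint f + cint g.
Proof.
move=> fP gP; rewrite /cint.
have -> : (fun U : MatBorel R d => complex.Re (f U + g U)) =
  (fun U => complex.Re (f U) + complex.Re (g U)).
  by apply/funext => U; case: (f U) (g U) => [? ?] [].
have -> : (fun U : MatBorel R d => complex.Im (f U + g U)) =
  (fun U => complex.Im (f U) + complex.Im (g U)).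
  by apply/funext => U; case: (f U) (g U) => [? ?] [].
by rewrite !RintegralD //;
  try exact: measurable_unitary_set; try exact: polyf_Re_integrable; try exact: polyf_Im_integrable.
Qed.

Lemma cint_scale c f : polyf f -> cint (fun U => c * f U) = c * cint f.
Proof.
move=> fP; case: c => a b; rewrite /cint.
have mU := measurable_unitary_set.
have fR := polyf_Re_integrable fP; have fI := polyf_Im_integrable fP.
have -> : (fun U : MatBorel R d => complex.Re ((a +i* b)%C * f U)) =
  (fun U => a * complex.Re (f U) + (- b) * complex.Im (f U)).
  by apply/funext => U; case: (f U) => [? ?] /=; rewrite mulNr.
have -> : (fun U : MatBorel R d => complex.Im ((a +i* b)%C * f U)) =
  (fun U => a * complex.Im (f U) + b * complex.Re (f U)).
  by apply/funext => U; case: (f U) => [? ?] /=.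
have iZ r (g : MatBorel R d -> R) : nu.-integrable unitary_set (EFin \o g) ->
    nu.-integrable unitary_set (EFin \o (fun U => r * g U)).
  by move=> gi; have := integrableZl mU r gi; apply: eq_integrable.
rewrite !RintegralD //; do ?exact: iZ.
by rewrite !RintegralZl // mulNr.
Qed.

Lemma cint_cst c : cint (fun=> c) = c.
Proof.
have nu1 : fine (nu unitary_set) = 1 by have -> : nu unitary_set = 1%E by exact: nuP.1.
have mU := measurable_unitary_set.
by case: c => a b; congr Complex; rewrite Rintegral_cst // -[RHS]mulr1; congr (_ * _).
Qed.

Lemma cint_mull V f : unitary V -> polyf f -> cint (fun U => f (V *m U)) = cint f.
Proof.
move=> VU fP; have [M MP] := polyf_bounded fP; congr Complex.
  apply: (@Rintegral_mulmx V (fun U => complex.Re (f U)) M) => //.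
    exact: polyf_Re_continuous.
  by move=> U UU; apply: Re_norm_le; exact: MP.
apply: (@Rintegral_mulmx V (fun U => complex.Im (f U)) M) => //.
  exact: polyf_Im_continuous.
by move=> U UU; apply: Im_norm_le; exact: MP.
Qed.

End HaarIntegral.

(** * Right invariance of the Haar integral *)

Section RightInvariance.
Variables (R : realType) (d : nat) (nu : probability (MatBorel R d) R).
Hypothesis nuP : is_haar nu.

(** Finite sums of products of a polynomial in [V] and one in [U]. On these, exchanging two
    integrals follows from linearity alone, without a product measure. *)
Inductive separated : ('M[Cx R]_d -> 'M[Cx R]_d -> Cx R) -> Prop :=
| separated_mul a b : polyf a -> polyf b -> separated (fun V U => a V * b U)
| separated_add F G : separated F -> separated G ->
    separated (fun V U => F V U + G V U).

Lemma separatedM F G : separated F -> separated G ->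
  separated (fun V U => F V U * G V U).
Proof.
move=> FP GP; elim: FP => [a b aP bP|F1 F2 _ IH1 _ IH2].
  elim: GP => [a' b' a'P b'P|G1 G2 _ IH1 _ IH2].
    rewrite (_ : (fun _ _ => _) = fun V U => (a V * a' V) * (b U * b' U)).
      by apply: separated_mul; exact: polyf_mul.
    by apply/funext => V; apply/funext => U; ring.
  rewrite (_ : (fun _ _ => _) = fun V U => (a V * b U) * G1 V U + (a V * b U) * G2 V U).
    exact: separated_add.
  by apply/funext => V; apply/funext => U; ring.
rewrite (_ : (fun _ _ => _) = fun V U => F1 V U * G V U + F2 V U * G V U).
  exact: separated_add.
by apply/funext => V; apply/funext => U; ring.
Qed.

Lemma separated_cst c : separated (fun _ _ => c).
Proof.
rewrite (_ : (fun _ _ => _) = fun V U : 'M[Cx R]_d => c * 1).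
  by apply: separated_mul; exact: polyf_cst.
by apply/funext => V; apply/funext => U; rewrite mulr1.
Qed.

Lemma separated_sum (I : Type) (s : seq I) (F : I -> 'M[Cx R]_d -> 'M[Cx R]_d -> Cx R) :
  (forall i, separated (F i)) -> separated (fun V U => \sum_(i <- s) F i V U).
Proof.
move=> FP; elim: s => [|i s IH].
  rewrite (_ : (fun _ _ => _) = fun _ _ => 0); first exact: separated_cst.
  by apply/funext => V; apply/funext => U; rewrite big_nil.
rewrite (_ : (fun _ _ => _) = fun V U => F i V U + \sum_(j <- s) F j V U).
  exact: separated_add.
by apply/funext => V; apply/funext => U; rewrite big_cons.
Qed.

Lemma separated_polyf F : separated F ->
  (forall V, polyf (F V)) /\ (forall U, polyf (F^~ U)).
Proof.
elim=> [a b aP bP|G H _ [G1 G2] _ [H1 H2]]; split => W.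
- by apply: polyf_mul => //; exact: polyf_cst.
- by apply: polyf_mul => //; exact: polyf_cst.
- exact: polyf_add.
- exact: polyf_add.
Qed.

Lemma separated_cint F : separated F ->
  [/\ polyf (fun V => cint nu (F V)), polyf (fun U => cint nu (F^~ U)) &
   cint nu (fun V => cint nu (F V)) = cint nu (fun U => cint nu (F^~ U))].
Proof.
elim=> [a b aP bP|G H GP [G1 G2 GE] HP [H1 H2 HE]].
  have -> : (fun V => cint nu (fun U => a V * b U)) = fun V => cint nu b * a V.
    by apply/funext => V; rewrite (cint_scale nuP) // mulrC.
  have -> : (fun U => cint nu (fun V => a V * b U)) = fun U => cint nu a * b U.
    apply/funext => U; rewrite mulrC -(cint_scale nuP) //.
    by congr (cint nu _); apply/funext => V; rewrite mulrC.
  split; [by apply: polyf_mul => //; exact: polyf_cst|by apply: polyf_mul => //; exact: polyf_cst|].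
  by rewrite !(cint_scale nuP) // mulrC.
have [[Gl Gr] [Hl Hr]] := (separated_polyf GP, separated_polyf HP).
have -> : (fun V => cint nu (fun U => G V U + H V U)) =
    fun V => cint nu (G V) + cint nu (H V).
  by apply/funext => V; rewrite (cint_add nuP).
have -> : (fun U => cint nu (fun V => G V U + H V U)) =
    fun U => cint nu (G^~ U) + cint nu (H^~ U).
  by apply/funext => U; rewrite (cint_add nuP).
split; [exact: polyf_add|exact: polyf_add|].
by rewrite (cint_add nuP G1 H1) (cint_add nuP G2 H2) GE HE.
Qed.

Lemma separated_adj_mul f : polyf f -> separated (fun V U => f (adjmx V *m U)).
Proof.
elim=> [c|i j|i j|g h _ IHg _ IHh|g h _ IHg _ IHh].
- exact: separated_cst.
- rewrite (_ : (fun _ _ => _) = fun V U : 'M[Cx R]_d => \sum_k (V k i)^* * U k j).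
    by apply: separated_sum => k; apply: separated_mul; [exact: polyf_conj|exact: polyf_coord].
  apply/funext => V; apply/funext => U; rewrite mxE.
  by apply: eq_bigr => k _; rewrite !mxE.
- rewrite (_ : (fun _ _ => _) = fun V U : 'M[Cx R]_d => \sum_k V k i * (U k j)^*).
    by apply: separated_sum => k; apply: separated_mul; [exact: polyf_coord|exact: polyf_conj].
  apply/funext => V; apply/funext => U; rewrite mxE rmorph_sum.
  by apply: eq_bigr => k _; rewrite !mxE rmorphM /= conjCK.
- exact: separated_add.
- exact: separatedM.
Qed.

Lemma polyf_comp_adj (f : 'M[Cx R]_d -> Cx R) : polyf f -> polyf (fun U => f (adjmx U)).
Proof.
apply: polyf_comp => i j.
  by under eq_fun do rewrite !mxE; exact: polyf_conj.
by under eq_fun do rewrite !mxE conjCK; exact: polyf_coord.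
Qed.

(* Integrate [f (V^* U)] in both orders: one order gives the integral of [f],
   the other one that of [f \o adjmx]. *)
Lemma cint_adj f : polyf f -> cint nu (fun U => f (adjmx U)) = cint nu f.
Proof.
move=> fP; have fadjP := polyf_comp_adj fP.
have [_ _] := separated_cint (separated_adj_mul fP).
rewrite (cint_ext _ (g := fun=> cint nu f)) => [|V VU]; last first.
  exact: (cint_mull nuP (unitary_adj VU) fP).
rewrite [RHS](cint_ext _ (g := fun=> cint nu (fun U => f (adjmx U)))) => [|U UU]; last first.
  rewrite -[RHS](cint_mull nuP (unitary_adj UU) fadjP).
  by congr (cint nu _); apply/funext => V; rewrite adjmxM adjmxK.
by rewrite !(cint_cst nuP).
Qed.

(** U V is the adjoint of V^* U^*, so invariance under adjoints turns left invariance into right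
    invariance. *)
Lemma cint_mulr V f : unitary V -> polyf f -> cint nu (fun U => f (U *m V)) = cint nu f.
Proof.
move=> VU fP; have fadjP := polyf_comp_adj fP.
have fVP : polyf (fun U => f (U *m V)).
  have := polyf_comp_adj (polyf_comp_mull (adjmx V) fadjP).
  by under eq_fun do rewrite adjmxM !adjmxK.
rewrite -(cint_adj fVP) -[RHS](cint_adj fP) -[RHS](cint_mull nuP (unitary_adj VU) fadjP).
by congr (cint nu _); apply/funext => U; rewrite adjmxM adjmxK.
Qed.

Lemma cint_minv (z : Cx R) : z ^+ 7 = 1 -> monomial_invariant z (cint nu).
Proof.
move=> z7; have zc7 : z^* ^+ 7 = 1 by rewrite -rmorphXn z7 rmorph1.
have zc : z = z^* ^+ 6.
  by rewrite -[RHS]mulr1 -(root7_norm z7) mulrCA -exprSr zc7 mulr1.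
split => [f g fP gP fg|f g fP gP|c f fP|s t f fP|s t f fP].
- exact: cint_ext.
- exact: (cint_add nuP).
- exact: (cint_scale nuP).
- rewrite -[RHS](cint_mull nuP (unitary_kmx z7 (s, [ffun i => inZp (t i)])) fP).
  congr (cint nu _); apply/funext => U; congr f; apply/matrixP => i j.
  by rewrite kmx_mulE mxE ffunE /= (expr_mod _ z7).
- rewrite -[RHS](cint_mulr (unitary_adj (unitary_kmx z7 (s, [ffun i => inZp (6 * t i)%N]))) fP).
  congr (cint nu _); apply/funext => U; congr f; apply/matrixP => i j.
  by rewrite mul_kmxE mxE ffunE /= (expr_mod _ zc7) exprM -zc.
Qed.

End RightInvariance.

(** * Haar moments of the entries *)

Section MixAlgebra.
Variables (C : numFieldType) (I : C).
Hypothesis I2 : I * I = -1.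

(** [I] is the imaginary unit and primed variables stand for conjugates: the left side is the
    squared modulus of an entry mixed with phase [w]. *)
Lemma mix_modulus (w w' x x' y y' : C) : w * w' = 1 ->
  ((1 + I) / 2 * x + (1 - I) / 2 * (w * y)) * ((1 - I) / 2 * x' + (1 + I) / 2 * (w' * y')) =
  (x * x' + y * y') / 2 + (I / 2 * w' * (x * y') + - (I / 2 * w) * (x' * y)).
Proof.
move=> ww; transitivity ((1 - I * I) / 4 * (x * x' + w * w' * (y * y')) +
     ((1 + I * I + 2 * I) / 4 * w' * (x * y') + (1 + I * I - 2 * I) / 4 * w * (x' * y))).
  by field.
by rewrite ww I2; field.
Qed.

(** [s] is a sum of two squared moduli, [P] their cross term and [Q] its conjugate. Summing over the
    four phases removes all products of [P] and [Q] with unequal exponents, here and for the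
    cube. *)
Lemma mix_square_sum (s P Q : C) :
  ((s / 2 + (I / 2 * 1 * P + - (I / 2 * 1) * Q)) ^+ 2 +
   (s / 2 + (I / 2 * -1 * P + - (I / 2 * -1) * Q)) ^+ 2) +
  ((s / 2 + (I / 2 * - I * P + - (I / 2 * I) * Q)) ^+ 2 +
   (s / 2 + (I / 2 * I * P + - (I / 2 * - I) * Q)) ^+ 2) = s ^+ 2 + 2 * (P * Q).
Proof.
transitivity (s ^+ 2 + (I * I) * (P - Q) ^+ 2 / 2 + (I * I) ^+ 2 * (P + Q) ^+ 2 / 2).
  by field.
by rewrite I2; field.
Qed.

Lemma mix_cube_sum (s P Q : C) :
  ((s / 2 + (I / 2 * 1 * P + - (I / 2 * 1) * Q)) ^+ 3 +
   (s / 2 + (I / 2 * -1 * P + - (I / 2 * -1) * Q)) ^+ 3) +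
  ((s / 2 + (I / 2 * - I * P + - (I / 2 * I) * Q)) ^+ 3 +
   (s / 2 + (I / 2 * I * P + - (I / 2 * - I) * Q)) ^+ 3) = s ^+ 3 / 2 + 3 * s * (P * Q).
Proof.
transitivity (s ^+ 3 / 2 + 3 / 4 * s * ((I * I) * (P - Q) ^+ 2 + (I * I) ^+ 2 * (P + Q) ^+ 2)).
  by field.
by rewrite I2; field.
Qed.

Lemma mix_unitary_off : (1 - I) / 2 * ((1 - I) / 2) + (1 + I) / 2 * ((1 + I) / 2) = 0.
Proof. by transitivity ((1 + I * I) / 2); [field|rewrite I2 subrr mul0r]. Qed.

Lemma mix_unitary_diag : (1 + I) / 2 * ((1 - I) / 2) + (1 + I) / 2 * ((1 - I) / 2) = 1.
Proof. by transitivity ((1 - I * I) / 2); [field|rewrite I2; field]. Qed.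

End MixAlgebra.

Section Moments.
Variables (R : realType) (d : nat) (nu : probability (MatBorel R d) R).
Hypothesis nuP : is_haar nu.
Local Notation L := (cint nu).

Let LP : monomial_invariant 1 L.
Proof. by apply: (cint_minv nuP); rewrite expr1n. Qed.

(* A square root of the transposition of [i] and [k]: it turns entry [i] of a
   column into an equal-weight combination of the entries [i] and [k], so left
   invariance relates the moments of one entry to the mixed moments of two.
   Summing over a relative phase in {1, 'i, -1, -'i} removes the cross terms. *)
Definition mixmx (i k : 'I_d) : 'M[Cx R]_d :=
  ((1 + 'i) / 2)%:M + ((1 - 'i) / 2) *: perm_mx (tperm i k).

Lemma adj_perm_tperm (i k : 'I_d) : adjmx (perm_mx (tperm i k)) = perm_mx (tperm i k) :> 'M[Cx R]_d.
Proof. by rewrite /adjmx map_perm_mx tr_perm_mx tpermV. Qed.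

Lemma mixmx_mulE i k (U : 'M[Cx R]_d) a b :
  (mixmx i k *m U) a b = (1 + 'i) / 2 * U a b + (1 - 'i) / 2 * U (tperm i k a) b.
Proof. by rewrite /mixmx mulmxDl mul_scalar_mx -scalemxAl -row_permE !mxE. Qed.

Lemma unitary_mixmx i k : unitary (mixmx i k).
Proof.
have i2 : 'i * 'i = -1 :> Cx R by rewrite -expr2 sqrCi.
have conjE (e : Cx R) : ((1 + e) / 2)^* = (1 + e^* ) / 2.
  by rewrite fmorph_div rmorphD rmorph1 rmorph_nat.
have adjE : adjmx (mixmx i k) = ((1 - 'i) / 2)%:M + ((1 + 'i) / 2) *: perm_mx (tperm i k).
  rewrite /mixmx /adjmx map_mxD map_scalar_mx map_mxZ linearD linearZ /= tr_scalar_mx !conjE rmorphN /= conjCi.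
  by rewrite -[X in _ + _ *: X]/(adjmx (perm_mx (tperm i k))) adj_perm_tperm opprK.
rewrite /unitary adjE /mixmx mulmxDr !mulmxDl -!scalemxAr -!scalemxAl !mul_scalar_mx !mul_mx_scalar.
rewrite -perm_mxM tperm2 perm_mx1 -[((1 - 'i) / 2)%:M]scalemx1 -[RHS]scale1r !scalerA.
rewrite -addrA [X in _ + X]addrA -scalerDl.
by rewrite (mix_unitary_off i2) scale0r add0r -scalerDl (mix_unitary_diag i2).
Qed.

Lemma diag_row_mulE (c : 'I_d -> Cx R) (U : 'M[Cx R]_d) a b :
  (diag_mx (\row_j c j) *m U) a b = c a * U a b.
Proof. by rewrite mul_diag_mx !mxE. Qed.

Lemma unitary_diag_row (c : 'I_d -> Cx R) :
  (forall a, c a * (c a)^* = 1) -> unitary (diag_mx (\row_j c j)).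
Proof.
move=> cc; apply/matrixP => a b; rewrite diag_row_mulE !mxE eq_sym.
have [->|_] := eqVneq a b; first by rewrite !mulr1n cc.
by rewrite mulr0n rmorph0 mulr0.
Qed.

(** Left invariance under a diagonal matrix with phase [w] in row [k], combined with that under
    [mixmx]. *)
Lemma cint_mix_pow w i k j m : i != k -> w * w^* = 1 ->
  L (fun U => (((1 + 'i) / 2 * U i j + (1 - 'i) / 2 * (w * U k j)) *
               ((1 - 'i) / 2 * (U i j)^* + (1 + 'i) / 2 * (w^* * (U k j)^* ))) ^+ m) =
  L (fun U => sq i j U ^+ m).
Proof.
move=> ik ww.
have sP : polyf (fun U : 'M[Cx R]_d => sq i j U ^+ m) by exact/polyf_exp/polyf_sq.
rewrite -[RHS](cint_mull nuP (unitary_mixmx i k) sP).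
have cU : unitary (diag_mx (\row_a (if a == k then w else 1))).
  by apply: unitary_diag_row => a; case: ifP; rewrite ?rmorph1 ?mulr1.
rewrite -[RHS](cint_mull nuP cU (polyf_comp_mull _ sP)).
congr L; apply/funext => U; congr (_ ^+ _); rewrite /sq mixmx_mulE !diag_row_mulE tpermL.
rewrite (negbTE ik) eqxx mul1r; congr (_ * _).
by rewrite rmorphD !rmorphM /= !rmorphD rmorphN /= conjCi rmorph1 fmorphV rmorph_nat opprK.
Qed.

Lemma cint_mix w i k j m : i != k -> w * w^* = 1 ->
  L (fun U => ((sq i j U + sq k j U) / 2 +
    ('i / 2 * w^* * (U i j * (U k j)^* ) + - ('i / 2 * w) * ((U i j)^* * U k j))) ^+ m) =
  L (fun U => sq i j U ^+ m).
Proof.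
move=> ik ww; rewrite -(cint_mix_pow j m ik ww); congr L; apply/funext => U; congr (_ ^+ _).
by rewrite (mix_modulus _ _ _ _ _ ww) // -expr2 sqrCi.
Qed.

Lemma cint_mix_sum i k j m : i != k ->
  4 * L (fun U => sq i j U ^+ m) =
  L (fun U =>
    ((((sq i j U + sq k j U) / 2 +
      ('i / 2 * 1 * (U i j * (U k j)^* ) + - ('i / 2 * 1) * ((U i j)^* * U k j))) ^+ m +
     ((sq i j U + sq k j U) / 2 +
      ('i / 2 * -1 * (U i j * (U k j)^* ) + - ('i / 2 * -1) * ((U i j)^* * U k j))) ^+ m) +
    (((sq i j U + sq k j U) / 2 +
      ('i / 2 * - 'i * (U i j * (U k j)^* ) + - ('i / 2 * 'i) * ((U i j)^* * U k j))) ^+ m +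
     ((sq i j U + sq k j U) / 2 +
      ('i / 2 * 'i * (U i j * (U k j)^* ) + - ('i / 2 * - 'i) * ((U i j)^* * U k j))) ^+ m))).
Proof.
move=> ik.
have gP c c' : polyf (fun U : 'M[Cx R]_d => ((sq i j U + sq k j U) / 2 +
    (c * (U i j * (U k j)^* ) + c' * ((U i j)^* * U k j))) ^+ m).
  apply/polyf_exp/polyf_add.
    by apply: polyf_mul; [apply: polyf_add; exact: polyf_sq|exact: polyf_cst].
  apply: polyf_add; (apply: polyf_mul; first exact: polyf_cst); apply: polyf_mul;
    by [exact: polyf_conj|exact: polyf_coord].
have ii : 'i * 'i = -1 :> Cx R by rewrite -expr2 sqrCi.
have m1 : (1 : Cx R) * 1^* = 1 by rewrite rmorph1 mulr1.
have mN1 : (-1 : Cx R) * (-1)^* = 1 by rewrite rmorphN rmorph1 mulrNN mulr1.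
have mi : ('i : Cx R) * 'i^* = 1 by rewrite conjCi mulrN ii opprK.
have mNi : (- 'i : Cx R) * (- 'i)^* = 1 by rewrite rmorphN /= conjCi opprK mulNr ii opprK.
have e1 := cint_mix j m ik m1; have eN1 := cint_mix j m ik mN1.
have ei := cint_mix j m ik mi; have eNi := cint_mix j m ik mNi.
rewrite rmorph1 in e1; rewrite rmorphN /= rmorph1 in eN1.
rewrite conjCi in ei; rewrite rmorphN /= conjCi opprK in eNi.
rewrite (minv_add LP); try by [apply: polyf_add; exact: gP].
rewrite !(minv_add LP); try by exact: gP.
rewrite e1 eN1 ei eNi; ring.
Qed.

Lemma cint_sq_perm i k j m : L (fun U => sq i j U ^+ m) = L (fun U => sq k j U ^+ m).
Proof.
rewrite -[RHS](minv_perm_row LP (tperm k i)); last exact/polyf_exp/polyf_sq.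
by congr L; apply/funext => U; rewrite /sq !mxE tpermL.
Qed.

Lemma cint_sqX_mul i k j m n :
  L (fun U => sq i j U ^+ m * sq k j U ^+ n) = L (fun U => sq k j U ^+ m * sq i j U ^+ n).
Proof.
rewrite -[RHS](minv_perm_row LP (tperm k i)); last by apply: polyf_mul; exact/polyf_exp/polyf_sq.
by congr L; apply/funext => U; rewrite /sq !mxE tpermL tpermR.
Qed.

Lemma cint_marginal f j : polyf f ->
  \sum_k L (fun U => f U * sq k j U) = L f.
Proof.
move=> fP; rewrite -(minv_sum LP) => [|k]; last by apply: polyf_mul => //; exact: polyf_sq.
apply: cint_ext => U UU; rewrite -mulr_sumr.
by rewrite (unitary_col j j UU) eqxx mulr1.
Qed.

Lemma sum_diag_off (i : 'I_d) (F : 'I_d -> Cx R) a b :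
  F i = a -> (forall k, i != k -> F k = b) -> \sum_k F k = a + d.-1%:R * b.
Proof.
move=> Fi Fk; rewrite (bigD1 i) //= Fi; congr (_ + _).
rewrite (eq_bigr (fun=> b)) => [|k ki]; last by rewrite Fk // eq_sym.
rewrite sumr_const mulr_natl; congr (_ *+ _).
by rewrite -[d in RHS]card_ord (cardC1 i).
Qed.

Lemma cint_sq1 i j : d%:R * L (sq i j) = 1.
Proof.
rewrite -[RHS](cint_cst nuP 1) -(cint_marginal j (polyf_cst d 1)).
rewrite (eq_bigr (fun=> L (sq i j))) => [|k _]; first by rewrite sumr_const card_ord mulr_natl.
rewrite [RHS](_ : _ = L (fun U => sq i j U ^+ 1)) // (cint_sq_perm i k).
by congr L; apply/funext => U; rewrite mul1r.
Qed.

(** With A the fourth moment of an entry and B the mixed moment, the four-phase sum reads 4 A = 2 A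
    + 4 B. *)
Lemma cint_sq11 i k j : i != k ->
  2 * L (fun U => sq i j U * sq k j U) = L (fun U => sq i j U ^+ 2).
Proof.
move=> ik; have := cint_mix_sum j 2 ik.
have ii : 'i * 'i = -1 :> Cx R by rewrite -expr2 sqrCi.
under [X in _ = L X -> _]eq_fun do rewrite (mix_square_sum ii).
rewrite [X in _ = L X -> _](_ : _ = fun U => (sq i j U ^+ 2 + sq k j U ^+ 2) + 4 * (sq i j U * sq k j U));
  last by apply/funext => U; rewrite /sq; ring.
have sP a n : polyf (fun U : 'M[Cx R]_d => sq a j U ^+ n) by exact/polyf_exp/polyf_sq.
have mP : polyf (fun U : 'M[Cx R]_d => sq i j U * sq k j U) by apply: polyf_mul; exact: polyf_sq.
rewrite !(minv_add LP) // ?(minv_scale LP) //;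
  try by [exact: polyf_add|apply: polyf_mul => //; exact: polyf_cst].
rewrite (cint_sq_perm k i) => e.
apply: (mulfI (_ : 2 != 0 :> Cx R)); first by rewrite pnatr_eq0.
transitivity (4 * L (fun U => sq i j U ^+ 2) - 2 * L (fun U => sq i j U ^+ 2)); last by ring.
by rewrite e; ring.
Qed.

(** Inserting the column sum 1 expresses the second moment as A + (d - 1) A / 2, with A the fourth
    moment. *)
Lemma cint_sq2 i j : d.+1%:R * L (fun U => sq i j U ^+ 2) = 2 * L (sq i j).
Proof.
rewrite -(cint_marginal j (polyf_sq R i j)).
rewrite (@sum_diag_off i _ (L (fun U => sq i j U ^+ 2)) (L (fun U => sq i j U ^+ 2) / 2)).
- have d0 : (0 < d)%N by apply: leq_ltn_trans (ltn_ord i).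
  have dE : d%:R = d.-1%:R + 1 :> Cx R by rewrite natr1 prednK.
  by rewrite -natr1 dE; field.
- by congr L.
- by move=> k ik; rewrite -(cint_sq11 j ik) mulrC mulKf // pnatr_eq0.
Qed.

(** Now A is the sixth moment of an entry and B the mixed one, and the four-phase sum reads 4 A = A
    + 9 B. *)
Lemma cint_sq21 i k j : i != k ->
  3 * L (fun U => sq i j U ^+ 2 * sq k j U) = L (fun U => sq i j U ^+ 3).
Proof.
move=> ik; have := cint_mix_sum j 3 ik.
have ii : 'i * 'i = -1 :> Cx R by rewrite -expr2 sqrCi.
under [X in _ = L X -> _]eq_fun do rewrite (mix_cube_sum ii).
rewrite [X in _ = L X -> _](_ : _ = fun U => 2^-1 * (sq i j U ^+ 3 + sq k j U ^+ 3) +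
    9 / 2 * (sq i j U ^+ 2 * sq k j U ^+ 1 + sq k j U ^+ 2 * sq i j U ^+ 1));
  last by apply/funext => U; rewrite /sq; field.
have sP a n : polyf (fun U : 'M[Cx R]_d => sq a j U ^+ n) by exact/polyf_exp/polyf_sq.
have mP a b m n : polyf (fun U : 'M[Cx R]_d => sq a j U ^+ m * sq b j U ^+ n).
  by apply: polyf_mul.
rewrite (minv_add LP); try by [apply: polyf_mul; [exact: polyf_cst|exact: polyf_add]].
rewrite !(minv_scale LP) ?(minv_add LP) //; try by exact: polyf_add.
rewrite (cint_sq_perm k i) (cint_sqX_mul k i) => e.
apply: (mulfI (_ : 3 != 0 :> Cx R)); first by rewrite pnatr_eq0.
transitivity (4 * L (fun U => sq i j U ^+ 3) - L (fun U => sq i j U ^+ 3)); last by ring.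
by rewrite e; field.
Qed.

Lemma cint_sq3 i j : d.+2%:R * L (fun U => sq i j U ^+ 3) = 3 * L (fun U => sq i j U ^+ 2).
Proof.
have sP : polyf (fun U : 'M[Cx R]_d => sq i j U ^+ 2) by exact/polyf_exp/polyf_sq.
rewrite -(cint_marginal j sP).
rewrite (@sum_diag_off i _ (L (fun U => sq i j U ^+ 3)) (L (fun U => sq i j U ^+ 3) / 3)).
- have d0 : (0 < d)%N by apply: leq_ltn_trans (ltn_ord i).
  have dE : d%:R = d.-1%:R + 1 :> Cx R by rewrite natr1 prednK.
  by rewrite -[d.+2%:R]natr1 -[d.+1%:R]natr1 dE; field.
- by congr L; apply/funext => U; rewrite -exprSr.
- by move=> k ik; rewrite -(cint_sq21 j ik) mulrC mulKf // pnatr_eq0.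
Qed.

End Moments.

(** * The Fourier matrix and a one-parameter family *)

Section SixthRoot.
Variable R : realType.

(** The witness is exp(i pi / 3). Its quadratic equation and its conjugate are all that the later
    computations need. *)
Lemma sixth_root_exists : exists w : Cx R, w ^+ 2 = w - 1 /\ w^* = 1 - w.
Proof.
have s2 : sqrtC 3 * sqrtC 3 = 3 :> Cx R by rewrite -expr2 sqrtCK.
have sc : (sqrtC 3 : Cx R)^* = sqrtC 3 by apply: geC0_conj; rewrite sqrtC_ge0 ler0n.
have i2 : 'i * 'i = -1 :> Cx R by rewrite -expr2 sqrCi.
exists ((1 + 'i * sqrtC 3) / 2); split.
  transitivity ((1 + 2 * ('i * sqrtC 3) + ('i * 'i) * (sqrtC 3 * sqrtC 3)) / 4 : Cx R); first by field.
  by rewrite i2 s2; field.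
by rewrite fmorph_div rmorphD rmorph1 rmorphM /= conjCi sc rmorph_nat; field.
Qed.

Variable w : Cx R.
Hypothesis w2 : w ^+ 2 = w - 1.
Hypothesis wc : w^* = 1 - w.

Lemma sixth_root_norm : w * w^* = 1.
Proof. by rewrite wc mulrBr mulr1 -expr2 w2 opprB addrC subrK. Qed.

Lemma sixth_root3 : w ^+ 3 = -1.
Proof. by rewrite exprS w2 mulrBr mulr1 -expr2 w2 addrAC subrr add0r. Qed.

Lemma sixth_root6 : w ^+ 6 = 1.
Proof. by rewrite (exprM _ 3 2) sixth_root3 sqrrN expr1n. Qed.

Lemma sixth_root_prim : 6.-primitive_root w.
Proof.
have [m mP m6] := prim_order_exists (isT : (0 < 6)%N) sixth_root6.
have : m \in divisors 6 by rewrite -dvdn_divisors.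
rewrite (_ : divisors 6 = [:: 1; 2; 3; 6]%N) // !inE.
move=> /or4P[] /eqP mE; last by rewrite -mE.
- have := prim_expr_order mP; rewrite mE expr1 => w1.
  by have /eqP := w2; rewrite w1 expr1n subrr oner_eq0.
- have := prim_expr_order mP; rewrite mE w2 => /eqP; rewrite subr_eq => /eqP w1.
  have /eqP := w2; rewrite w1 -(natrD _ 1 1) -natrX -(natrB _ (isT : (1 <= 2)%N)) eqr_nat.
  by [].
- have := prim_expr_order mP; rewrite mE sixth_root3 => /eqP.
  by rewrite eqNr oner_eq0.
Qed.

(** For b = 0, ..., 5 the squared distance from 1 to [w ^+ b] is 0, 1, 3, 4, 3, 1. This number
    determines the moduli of the entries of [umx (w ^+ b)]. *)
Lemma alternating_sixth_sum (f : Cx R -> Cx R) :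
  \sum_(b < 6) (-1) ^+ b * f (2 - w ^+ b - w^* ^+ b) = f 0 - 2 * f 1 + 2 * f 3 - f 4.
Proof.
have c2 : w^* ^+ 2 = - w by rewrite -rmorphXn w2 rmorphB rmorph1 /= wc; ring.
have c3 : w^* ^+ 3 = -1 by rewrite -rmorphXn sixth_root3 rmorphN rmorph1.
rewrite !big_ord_recl big_ord0 /= /bump /=.
rewrite (exprD w 3 1) (exprD w 3 2) (exprD w^* 3 1) (exprD w^* 3 2) c2 c3 sixth_root3 w2 wc.
rewrite !expr0 !expr1.
have -> : 2 - 1 - 1 = 0 :> Cx R by ring.
have -> : 2 - w - (1 - w) = 1 by ring.
have -> : 2 - (w - 1) - (- w) = 3 by ring.
have -> : 2 - -1 - -1 = 4 :> Cx R by ring.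
have -> : 2 - (-1 * w) - (-1 * (1 - w)) = 3 by ring.
have -> : 2 - (-1 * (w - 1)) - (-1 * (- w)) = 1 by ring.
ring.
Qed.

(** The summand depends only on b - a modulo 6; this includes the sign, because 6 is even. *)
Lemma sixth_root_translate (f : Cx R -> Cx R) :
  \sum_(a < 6) \sum_(b < 6) (-1) ^+ a * f (w^* ^+ a * w ^+ b) * (-1) ^+ b =
  6 * \sum_(b < 6) (-1) ^+ b * f (w ^+ b).
Proof.
have N6 : (-1 : Cx R) ^+ 6 = 1 by rewrite (exprM _ 2 3) sqrrN !expr1n.
rewrite (eq_bigr (fun=> \sum_(b < 6) (-1) ^+ b * f (w ^+ b))) => [|a _].
  by rewrite sumr_const card_ord mulr_natl.
rewrite (reindex_inj (addIr (a : 'I_6))) /=; apply: eq_bigr => b _.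
have expE (x : Cx R) : x ^+ 6 = 1 -> x ^+ nat_of_ord (b + a)%R = x ^+ b * x ^+ a.
  by move=> x6; rewrite /= expr_mod // exprD.
have wE : w^* ^+ a * (w ^+ b * w ^+ a) = w ^+ b.
  by rewrite mulrCA -exprMn [w^* * w]mulrC sixth_root_norm expr1n mulr1.
have sE : (-1) ^+ a * (-1) ^+ a = 1 :> Cx R by rewrite -exprMn mulrNN mulr1 expr1n.
by rewrite (expE _ sixth_root6) (expE (-1) N6) wE mulrAC mulrCA sE mulr1.
Qed.

End SixthRoot.

(** * Power sums of the squared moduli at special unitary matrices *)

Section SpecialMatrices.
Variable R : realType.

Lemma Fpow_of_diag_off n k (U : 'M[Cx R]_n) a b :
  (forall i, sq i i U = a) -> (forall i j, i != j -> sq i j U = b) ->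
  Fpow k U = n%:R * (a ^+ k + n.-1%:R * b ^+ k).
Proof.
move=> Ua Ub; rewrite /Fpow (eq_bigr (fun=> a ^+ k + n.-1%:R * b ^+ k)) => [|i _].
  by rewrite sumr_const card_ord -[LHS]mulr_natl.
by apply: (@sum_diag_off _ _ i); [rewrite Ua|move=> j ij; rewrite Ub].
Qed.

Lemma Fpow1 n k : (0 < k)%N -> Fpow k (1%:M : 'M[Cx R]_n) = n%:R.
Proof.
move=> k0; rewrite (@Fpow_of_diag_off _ _ _ 1 0) => [|i|i j ij].
- by rewrite expr1n expr0n eqn0Ngt k0 mulr0 addr0 mulr1.
- by rewrite /sq !mxE eqxx mulr1n rmorph1 mulr1.
- by rewrite /sq !mxE (negbTE ij) mul0r.
Qed.

Lemma hadamard_sq n (H : 'M[Cx R]_n) i j : hadamard H -> sq i j H = n%:R^-1.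
Proof. by case=> _ HP; rewrite /sq -normCK HP exprVn sqrtCK. Qed.

Lemma Fpow_hadamard n k (H : 'M[Cx R]_n) : hadamard H ->
  Fpow k H = n%:R ^+ 2 * (n%:R ^- k).
Proof.
move=> HP; rewrite /Fpow (eq_bigr (fun=> n%:R * n%:R ^- k)) => [|i _].
  by rewrite sumr_const card_ord -[LHS]mulr_natl mulrA expr2.
rewrite (eq_bigr (fun=> n%:R ^- k)) => [|j _]; last by rewrite hadamard_sq // exprVn.
by rewrite sumr_const card_ord -[LHS]mulr_natl.
Qed.

(* Multiplies the vector (1,...,1) by [v] and fixes its orthogonal complement. *)
Definition umx (v : Cx R) : 'M[Cx R]_6 := 1%:M + ((v - 1) / 6) *: const_mx 1.

Lemma umx1 : umx 1 = 1%:M.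
Proof. by rewrite /umx subrr mul0r scale0r addr0. Qed.

Lemma adj_umx v : adjmx (umx v) = umx v^*.
Proof.
apply/matrixP => i j; rewrite !mxE eq_sym !mulr1 rmorphD rmorphMn rmorph1 /=.
by rewrite fmorph_div rmorphB rmorph1 rmorph_nat.
Qed.

Lemma umxM u v : umx u *m umx v = umx (u * v).
Proof.
rewrite /umx mulmxDl !mulmxDr !mul1mx mulmx1 -scalemxAl -scalemxAr.
have -> : (const_mx 1 : 'M[Cx R]_6) *m (const_mx 1 : 'M[Cx R]_6) = 6 *: const_mx 1.
  apply/matrixP => i j; rewrite !mxE (eq_bigr (fun=> 1)) => [|k _]; last by rewrite !mxE mulr1.
  by rewrite sumr_const card_ord mulr1.
rewrite !scalerA -!addrA; congr (_ + _); rewrite -!scalerDl; congr (_ *: _).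
by field.
Qed.

Lemma unitary_umx v : v * v^* = 1 -> unitary (umx v).
Proof. by move=> vv; rewrite /unitary adj_umx umxM vv umx1. Qed.

(** With s the squared distance from [v] to 1, the squared moduli are s / 36 off the diagonal and 1
    - 5 s / 36 on it. *)
Lemma Fpow_umx k v : v * v^* = 1 ->
  Fpow k (umx v) = 6 * ((1 - 5 * (2 - v - v^* ) / 36) ^+ k + 5 * ((2 - v - v^* ) / 36) ^+ k).
Proof.
move=> vv; apply: Fpow_of_diag_off => [i|i j ij].
  rewrite /sq !mxE eqxx !mulr1 mulr1n rmorphD rmorph1 fmorph_div rmorphB rmorph1 rmorph_nat.
  by transitivity ((25 + 5 * (v + v^* ) + v * v^* ) / 36); [field|rewrite vv; field].
rewrite /sq !mxE (negbTE ij) mulr1 mulr0n add0r fmorph_div rmorphB rmorph1 rmorph_nat.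
by transitivity ((1 - v - v^* + v * v^* ) / 36); [field|rewrite vv; field].
Qed.

Definition fouriermx (w : Cx R) : 'M[Cx R]_6 := \matrix_(i, j) (w ^+ (i * j) / sqrtC 6).

Lemma hadamard_fouriermx (w : Cx R) : w ^+ 2 = w - 1 -> w^* = 1 - w -> hadamard (fouriermx w).
Proof.
move=> w2 wc; have ww := sixth_root_norm w2 wc; have w6 := sixth_root6 w2.
have s0 : 0 <= sqrtC 6 :> Cx R by rewrite sqrtC_ge0 ler0n.
have ss : sqrtC 6 * sqrtC 6 = 6 :> Cx R by rewrite -expr2 sqrtCK.
have s6 : 6^-1 = (sqrtC 6)^-1 * (sqrtC 6)^-1 :> Cx R by rewrite -invfM ss.
split=> [|i j]; last first.
  have w1 : `|w| = 1 by apply/eqP; rewrite -(@pexpr_eq1 _ _ 2) // normCK ww.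
  by rewrite mxE normrM normrX w1 expr1n mul1r normfV ger0_norm.
apply/matrixP => i j; rewrite !mxE.
(* [u] is w to the power i - j: for distinct indices a sixth root of unity other than 1, whose six
   powers sum to 0. *)
pose u := w ^+ i * w^* ^+ j.
rewrite (eq_bigr (fun k : 'I_6 => 6^-1 * u ^+ k)) => [|k _]; last first.
  rewrite !mxE fmorph_div rmorphXn /= (geC0_conj s0) /u exprMn -!exprM s6.
  by rewrite mulrACA mulrC.
rewrite -mulr_sumr; have [ij|ij] := eqVneq i j.
  rewrite (eq_bigr (fun=> 1)) => [|k _]; last by rewrite /u ij -exprMn ww !expr1n.
  by rewrite sumr_const card_ord mulVf // pnatr_eq0.
have u1 : u != 1.
  apply: contraNneq ij => u1; have : w ^+ i = w ^+ j.
    transitivity (w ^+ i * (w * w^* ) ^+ j); first by rewrite ww expr1n mulr1.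
    by rewrite exprMn mulrCA -/u u1 mulr1.
  by move/eqP; rewrite (eq_prim_root_expr (sixth_root_prim w2)) !modn_small.
have : (u - 1) * \sum_(k < 6) u ^+ k = 0.
  by rewrite -subrX1 /u exprMn -!exprM ![(_ * 6)%N]mulnC !exprM -rmorphXn w6 rmorph1 !expr1n mulr1 subrr.
by move/eqP; rewrite mulf_eq0 subr_eq0 (negbTE u1) /= => /eqP->; rewrite mulr0.
Qed.

End SpecialMatrices.

(** * Polynomials as sums of monomials *)

Lemma seventh_root_exists (R : realType) : exists z : Cx R, z ^+ 7 = 1 /\ z != 1.
Proof.
(* The coefficients -1 make [z] a root of 1 + X + ... + X^6, which takes the value 7 at 1. *)
have [z zP] := @GRing.solve_monicpoly (Cx R) 6 (fun=> -1) isT.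
have s0 : \sum_(i < 7) z ^+ i = 0.
  rewrite big_ord_recr /= zP -big_split big1 // => i _ /=.
  by rewrite mulN1r subrr.
exists z; split.
  by apply/eqP; rewrite -subr_eq0 subrX1 s0 mulr0.
apply/eqP => z1; move: s0; rewrite z1 (eq_bigr (fun=> 1)) => [|i _]; last by rewrite expr1n.
by rewrite sumr_const card_ord => /eqP; rewrite pnatr_eq0.
Qed.

Section PolyMon.
Variables (R : realType) (d : nat).

Lemma mxvec_coord : exists g : 'I_(d * d) -> 'I_d * 'I_d,
  forall (U : 'M[Cx R]_d) a, mxvec U 0 a = U (g a).1 (g a).2.
Proof.
exists (fun a => enum_val (cast_ord (esym (mxvec_cast d d)) a)) => U a.
by case/mxvec_indexP: a => i j; rewrite mxvecE cast_ordK enum_rankK.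
Qed.

(** Exponents become multiplicities in two lists, one for the first half of the variables (the
    entries) and one for the second half (their conjugates). *)
Lemma entry_vars_mon (m : mpoly.multinom (d * d + d * d)) :
  exists s t : seq ('I_d * 'I_d), (size s + size t)%N = mpoly.mdeg m /\
    forall U : 'M[Cx R]_d, \prod_i entry_vars U i ^+ mpoly.fun_of_multinom m i = mon s t U.
Proof.
have [g gP] := mxvec_coord.
pose S (m' : 'I_(d * d) -> nat) := flatten [seq nseq (m' a) (g a) | a <- index_enum 'I_(d * d)].
have SS m' : size (S m') = (\sum_a m' a)%N.
  rewrite size_flatten /shape -map_comp sumnE big_map.
  by apply: eq_bigr => i _; rewrite /= size_nseq.
have SP m' (F : 'I_d * 'I_d -> Cx R) : \prod_a F (g a) ^+ m' a = \prod_(p <- S m') F p.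
  rewrite big_flatten big_map; apply: eq_bigr => i _.
  by rewrite big_nseq iter_mulr_1.
exists (S (fun a => mpoly.fun_of_multinom m (lshift _ a))), (S (fun a => mpoly.fun_of_multinom m (rshift _ a))); split.
  by rewrite !SS mpoly.mdegE big_split_ord.
move=> U; rewrite big_split_ord /mon -!SP; congr (_ * _); apply: eq_bigr => a _.
  by rewrite /entry_vars -[lshift _ a]/(fintype.unsplit (inl a)) unsplitK gP.
by rewrite /entry_vars -[rshift _ a]/(fintype.unsplit (inr a)) unsplitK gP.
Qed.

Lemma poly_le_polyf k f : @poly_le R d k f ->
  exists r : seq (Cx R * (seq ('I_d * 'I_d) * seq ('I_d * 'I_d))),
    (forall p, p \in r -> (size p.2.1 + size p.2.2 <= k)%N) /\
    forall U, unitary U -> f U = \sum_(p <- r) p.1 * mon p.2.1 p.2.2 U.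
Proof.
case=> p [/allP pk pf].
have H (l : seq (mpoly.multinom (d * d + d * d))) : (forall m, m \in l -> (mpoly.mdeg m <= k)%N) ->
    exists r : seq (Cx R * (seq ('I_d * 'I_d) * seq ('I_d * 'I_d))),
    (forall q, q \in r -> (size q.2.1 + size q.2.2 <= k)%N) /\
    forall U : 'M[Cx R]_d, \sum_(m <- l) mpoly.mcoeff m p * \prod_i entry_vars U i ^+ mpoly.fun_of_multinom m i =
      \sum_(q <- r) q.1 * mon q.2.1 q.2.2 U.
  elim: l => [|m l IH] lk; first by exists [::]; split=> // U; rewrite !big_nil.
  have [|r [rk rE]] := IH; first by move=> m' m'l; apply: lk; rewrite inE m'l orbT.
  have [s [t [st stE]]] := entry_vars_mon m.
  exists ((mpoly.mcoeff m p, (s, t)) :: r); split.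
    move=> q; rewrite inE => /orP[/eqP->|/rk//]; rewrite /= st.
    by apply: lk; rewrite mem_head.
  by move=> U; rewrite !big_cons rE stE.
have [r [rk rE]] := H _ pk; exists r; split=> // U UU.
by rewrite pf // mpoly.mevalE rE.
Qed.

End PolyMon.

Section PolyLe.
Variables (R : realType) (d k : nat).

Lemma poly_le_ext (f g : 'M[Cx R]_d -> Cx R) :
  (forall U, unitary U -> f U = g U) -> poly_le k g -> poly_le k f.
Proof. by move=> fg [p [pk pg]]; exists p; split=> // U UU; rewrite fg // pg. Qed.

Lemma poly_le_scale c (f : 'M[Cx R]_d -> Cx R) :
  poly_le k f -> poly_le k (fun U => c * f U).
Proof.
case=> p [/allP pk pf]; exists (c *: p); split.
  by apply/allP => m /mpoly.msuppZ_le/pk.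
by move=> U UU; rewrite mpoly.mevalZ pf.
Qed.

Lemma poly_le_add (f g : 'M[Cx R]_d -> Cx R) :
  poly_le k f -> poly_le k g -> poly_le k (fun U => f U + g U).
Proof.
case=> p [/allP pk pf] [q [/allP qk qg]]; exists (p + q); split.
  apply/allP => m /mpoly.msuppD_le; rewrite mem_cat => /orP[/pk|/qk] //.
by move=> U UU; rewrite mpoly.mevalD pf // qg.
Qed.

Lemma poly_le_sum (I : Type) (s : seq I) (F : I -> 'M[Cx R]_d -> Cx R) :
  (forall i, poly_le k (F i)) -> poly_le k (fun U => \sum_(i <- s) F i U).
Proof.
move=> FP; elim: s => [|i s IH].
  exists 0; split; first by rewrite mpoly.msupp0.
  by move=> U _; rewrite big_nil mpoly.meval0.
by apply: poly_le_ext (poly_le_add (FP i) IH) => U _; rewrite big_cons.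
Qed.

Lemma entry_vars_lift : exists (v : 'I_d -> 'I_d -> 'I_(d * d + d * d)) (v' : 'I_d -> 'I_d -> 'I_(d * d + d * d)),
  forall (U : 'M[Cx R]_d) i j, entry_vars U (v i j) = U i j /\ entry_vars U (v' i j) = (U i j)^*.
Proof.
exists (fun i j => lshift _ (mxvec_index i j)), (fun i j => rshift _ (mxvec_index i j)) => U i j.
rewrite /entry_vars -[lshift _ _]/(fintype.unsplit (inl _)) unsplitK mxvecE.
by rewrite -[rshift _ _]/(fintype.unsplit (inr _)) unsplitK mxvecE.
Qed.

Lemma poly_le_sqX i j m : (2 * m <= k)%N -> @poly_le R d k (fun U => sq i j U ^+ m).
Proof.
move=> mk; have [v [v' vP]] := entry_vars_lift.
exists (mpoly.mpolyX _ (mpoly.mnm_muln (mpoly.mnm_add (mpoly.mnm1 (v i j)) (mpoly.mnm1 (v' i j))) m)); split.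
  rewrite mpoly.msuppX /= andbT mpoly.mdegMn mpoly.mdegD !mpoly.mdeg1.
  by rewrite addn1 (leq_trans _ mk).
move=> U UU; have [v1 v2] := vP U i j.
rewrite -mpoly.mpolyXn mpoly.mpolyXD rmorphXn rmorphM /= !mpoly.mevalXU v1 v2.
by [].
Qed.

Lemma poly_le_Fpow m : (2 * m <= k)%N -> @poly_le R d k (Fpow m).
Proof. by move=> mk; do 2! apply: poly_le_sum => ?; exact: poly_le_sqX. Qed.

Lemma poly_le_cst c : @poly_le R d k (fun=> c).
Proof.
exists (mpoly.mpolyC _ c); split; last by move=> U _; rewrite mpoly.mevalC.
apply/allP => m; rewrite mpoly.msuppC; case: ifP => // _.
by rewrite inE => /eqP->; rewrite mpoly.mdeg0.
Qed.

End PolyLe.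

(** * The two bounds *)

Section UpperBound.
Variable R : realType.
Implicit Types U g : 'M[Cx R]_6.

Lemma sum_pair_delta (F : 'I_6 -> 'I_6 -> Cx R) :
  \sum_(p : 'I_6 * 'I_6) (p.1 == p.2)%:R * F p.1 p.2 = \sum_k F k k.
Proof.
rewrite -(pair_big xpredT xpredT (fun k l => (k == l)%:R * F k l)) /=.
apply: eq_bigr => k _; rewrite (bigD1 k) //= eqxx mul1r big1 ?addr0 // => l lk.
by rewrite eq_sym (negbTE lk) mul0r.
Qed.

(** Entry [p] of the traceless part of the projection onto column [i] of [g]. *)
Definition tproj g i (p : 'I_6 * 'I_6) : Cx R :=
  g p.1 i * (g p.2 i)^* - (p.1 == p.2)%:R / 6.

(* The inner product of the traceless parts of two rank one projections. *)
Lemma tproj_gram g g' i j : unitary g -> unitary g' ->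
  \sum_p (tproj g i p)^* * tproj g' j p = sq i j (adjmx g *m g') - 6^-1.
Proof.
move=> gU g'U.
have tE p : (tproj g i p)^* * tproj g' j p =
    ((g p.1 i)^* * g' p.1 j) * (g p.2 i * (g' p.2 j)^* ) +
    (p.1 == p.2)%:R * (- 6^-1 * (g' p.1 j * (g' p.2 j)^* ) +
                       - 6^-1 * (g p.2 i * (g p.1 i)^* ) + 36^-1).
  rewrite /tproj rmorphB rmorphM /= conjCK fmorph_div !rmorph_nat.
  by case: (p.1 == p.2); rewrite ?mulr1n ?mulr0n; field.
under eq_bigr do rewrite tE.
rewrite big_split /= (sum_pair_delta (fun k l => - 6^-1 * (g' k j * (g' l j)^* ) +
                       - 6^-1 * (g l i * (g k i)^* ) + 36^-1)).
rewrite !big_split /= -!mulr_sumr !unitary_col // !eqxx sumr_const card_ord.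
rewrite -(pair_big xpredT xpredT (fun k l => ((g k i)^* * g' k j) * (g l i * (g' l j)^* ))) /=.
under eq_bigr do rewrite -mulr_sumr.
rewrite -mulr_suml; congr (_ + _); last by field.
rewrite /sq mxE rmorph_sum; congr (_ * _); apply: eq_bigr => k _; rewrite !mxE //.
by rewrite rmorphM /= conjCK.
Qed.

(** In each row the linear terms sum to -1/3 and the constants to 1/6, so the six rows contribute -1
    in all. *)
Lemma Fpow2_centered U : unitary U ->
  \sum_i \sum_j (sq i j U - 6^-1) ^+ 2 = Fpow 2 U - 1.
Proof.
move=> UU; rewrite /Fpow.
rewrite (eq_bigr (fun i => \sum_j sq i j U ^+ 2 + - 6^-1)) => [|i _].
  by rewrite big_split sumr_const card_ord /=; congr (_ + _); field.
rewrite (eq_bigr (fun j => (sq i j U ^+ 2 + - 3^-1 * sq i j U) + 36^-1)) => [|j _]; last by field.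
rewrite !big_split /= -mulr_sumr sum_sq_row // sumr_const card_ord -addrA; congr (_ + _).
by field.
Qed.

(** The square of a Gram kernel is the Gram kernel of the tensor squares. The sums over [i] and [j]
    separate, so the vector attached to [g] is the sum over [i] of [tproj g i] tensored with
    itself. *)
Lemma Fpow2_gram g g' : unitary g -> unitary g' ->
  Fpow 2 (invmx g *m g') - 1 =
  \sum_(q : ('I_6 * 'I_6) * ('I_6 * 'I_6))
    (\sum_i tproj g i q.1 * tproj g i q.2)^* * \sum_j tproj g' j q.1 * tproj g' j q.2.
Proof.
move=> gU g'U; rewrite unitary_inv // -Fpow2_centered; last exact/unitaryM/g'U/unitary_adj.
under eq_bigr => i _ do under eq_bigr => j _ do rewrite -tproj_gram // expr2 big_distrlr /= pair_big /=.
under eq_bigr do rewrite exchange_big /=.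
rewrite exchange_big /=; apply: eq_bigr => q _.
rewrite rmorph_sum big_distrlr /=; apply: eq_bigr => i _; apply: eq_bigr => j _.
by rewrite rmorphM /=; ring.
Qed.

(** The integral of [Fpow 2] is 36/21 = 12/7, so the factor 7/5 makes the integral 1. At the
    identity [Fpow 2] is 6, at a Hadamard matrix it is 1. *)
Definition hopt U : Cx R := 7 / 5 * (Fpow 2 U - 1).

Lemma pos_def_hopt : pos_def_on_U hopt.
Proof.
split.
  apply: continuous_subspaceT; apply: polyf_continuous.
  apply: polyf_mul; first exact: polyf_cst.
  by apply: polyf_add; [exact: polyf_Fpow|exact: polyf_cst].
move=> n g c gU.
pose Q a (q : ('I_6 * 'I_6) * ('I_6 * 'I_6)) := \sum_i tproj (g a) i q.1 * tproj (g a) i q.2.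
have -> : \sum_(a < n) \sum_(b < n) (c a)^* * hopt (invmx (g a) *m g b) * c b =
    7 / 5 * \sum_q (\sum_a c a * Q a q)^* * \sum_b c b * Q b q.
  under [in RHS]eq_bigr do rewrite rmorph_sum big_distrlr /=.
  rewrite [in RHS]exchange_big mulr_sumr; apply: eq_bigr => a _ /=.
  rewrite [in RHS]exchange_big mulr_sumr; apply: eq_bigr => b _ /=.
  rewrite /hopt Fpow2_gram // mulrCA -!mulrA; congr (_ * (_ * _)).
  rewrite [RHS](_ : _ = \sum_q ((c a)^* * c b) * ((Q a q)^* * Q b q)) ?mulr_suml ?mulr_sumr.
    by apply: eq_bigr => q _; rewrite /Q; ring.
  by apply: eq_bigr => q _; rewrite rmorphM /=; ring.
apply: mulr_ge0; first by rewrite divr_ge0 // ler0n.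
by apply: sumr_ge0 => q _; rewrite mulrC mul_conjC_ge0.
Qed.

Lemma sq_real n i j (U : 'M[Cx R]_n) : sq i j U \is Num.real.
Proof. by apply: ger0_real; exact: mul_conjC_ge0. Qed.

Lemma Fpow_real n k (U : 'M[Cx R]_n) : Fpow k U \is Num.real.
Proof. by do 2! apply: rpred_sum => ? _; apply: rpredX; exact: sq_real. Qed.

Variable nu : probability (MatBorel R 6) R.
Hypothesis nuP : is_haar nu.

Lemma cint_sq2_6 i j : cint nu (fun U => sq i j U ^+ 2) = 21^-1.
Proof.
have := cint_sq1 nuP i j; have := cint_sq2 nuP i j.
set A := cint _ _; set m := cint _ _ => e2 e1.
apply: (mulfI (_ : 42 != 0 :> Cx R)); first by rewrite pnatr_eq0.
by transitivity (6 * (7 * A)); [ring|rewrite e2 mulrCA e1; field].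
Qed.

Lemma cint_sq3_6 i j : cint nu (fun U => sq i j U ^+ 3) = 56^-1.
Proof.
have := cint_sq3 nuP i j; rewrite cint_sq2_6 => e.
apply: (mulfI (_ : 8 != 0 :> Cx R)); first by rewrite pnatr_eq0.
by rewrite e; field.
Qed.

Lemma cint_Fpow k c : (forall i j, cint nu (fun U => sq i j U ^+ k) = c) ->
  cint nu (Fpow k) = 36 * c.
Proof.
move=> ck; have LP := cint_minv nuP (expr1n (Cx R) 7).
have sP i j : polyf (fun U => sq i j U ^+ k) by exact/polyf_exp/polyf_sq.
rewrite /Fpow (minv_sum LP) => [|i]; last exact: polyf_sum.
rewrite (eq_bigr (fun=> 6 * c)) => [|i _]; first by rewrite sumr_const card_ord; ring.
rewrite (minv_sum LP) // (eq_bigr (fun=> c)) => [|j _]; last exact: ck.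
by rewrite sumr_const card_ord; ring.
Qed.

Lemma cint_hopt : cint nu hopt = 1.
Proof.
have FP := polyf_Fpow R 6 2.
rewrite /hopt (cint_scale nuP); last by apply: polyf_add => //; exact: polyf_cst.
rewrite (cint_add nuP) //; last exact: polyf_cst.
by rewrite (cint_cst nuP) (cint_Fpow cint_sq2_6); field.
Qed.

Lemma integral_Re_cint f : polyf f ->
  (\int[nu]_(U in [set U : MatBorel R 6 | unitary U]) (complex.Re (f U))%:E)%E
    = (complex.Re (cint nu f))%:E.
Proof.
move=> fP; rewrite /cint /= /Rintegral fineK //.
by apply: integrable_fin_num; [exact: measurable_unitary_set|exact: polyf_Re_integrable].
Qed.

Lemma hopt1 : hopt 1%:M = 7.
Proof. by rewrite /hopt Fpow1 //; field. Qed.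

Lemma admissible_hopt : admissible 6 nu hopt.
Proof.
split.
- exact: pos_def_hopt.
- apply: poly_le_scale; apply: poly_le_add; last exact: poly_le_cst.
  exact: poly_le_Fpow.
- move=> U UU; apply: rpredM; first by rewrite rpred_div ?rpred_nat.
  by rewrite rpredB ?Fpow_real ?rpred1.
- move=> H HP; rewrite /hopt (Fpow_hadamard 2 HP).
  by rewrite (_ : _ * _ = 0 :> Cx R) //; field.
- rewrite integral_Re_cint ?cint_hopt //.
  apply: polyf_mul; first exact: polyf_cst.
  by apply: polyf_add; [exact: polyf_Fpow|exact: polyf_cst].
Qed.

End UpperBound.

(** * Lower bound: a functional vanishing in degree at most 6 *)

Section LowerBound.
Variables (R : realType) (nu : probability (MatBorel R 6) R).
Hypothesis nuP : is_haar nu.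
Variables z w : Cx R.
Hypothesis z7 : z ^+ 7 = 1.
Hypothesis z1 : z != 1.
Hypothesis w2 : w ^+ 2 = w - 1.
Hypothesis wc : w^* = 1 - w.

(** The matrix is the product of the adjoint of [umx (w ^+ a)] with [umx (w ^+ b)], so this is a
    quadratic form with coefficients (-1)^a. The factor 1 fits the shape of [minv_lin_sum]. *)
Definition twist (f : 'M[Cx R]_6 -> Cx R) : Cx R :=
  \sum_(a < 6) 1 * \sum_(b < 6) ((-1) ^+ a * (-1) ^+ b) * biavg z (umx (w^* ^+ a * w ^+ b)) f.

(** The two averages, the integral and [twist] take the values 1, 1, 1, 0 at the constant 1; 6, 1,
    12/7, 0 at [Fpow 2]; and 6, 1/6, 9/14, 10/9 at [Fpow 3]. The weights 1, 6 and -7 cancel the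
    first two rows, and the third then forces 9/4. The grouping and the factors 1 fit [minv_lin]. *)
Definition dual_certificate (f : 'M[Cx R]_6 -> Cx R) : Cx R :=
  1 * (1 * biavg z 1%:M f + 6 * biavg z (fouriermx w) f) +
  -1 * (7 * cint nu f + 9 / 4 * twist f).

Lemma twist_unitary (a b : nat) : unitary (umx (w^* ^+ a * w ^+ b)).
Proof.
apply: unitary_umx; rewrite rmorphM !rmorphXn /= conjCK mulrACA -!exprMn.
by rewrite [w^* * w]mulrC (sixth_root_norm w2 wc) !expr1n mulr1.
Qed.

Lemma dual_certificate_minv : monomial_invariant z dual_certificate.
Proof.
have HP := hadamard_fouriermx w2 wc.
apply: minv_lin; apply: minv_lin.
- exact/biavg_minv/unitary1.
- by apply: (biavg_minv z7); case: HP.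
- exact: cint_minv.
- apply: minv_lin_sum => a; apply: minv_lin_sum => b.
  exact/(biavg_minv z7)/twist_unitary.
Qed.

(** The four groups of terms come from the squared distances 0, 1, 3 and 4 of powers of [w] from
    1. *)
Lemma twist_Fpow k : twist (Fpow k) =
  6 * ((6 * (1 + 5 * 0 ^+ k)) - 2 * (6 * ((31 / 36) ^+ k + 5 * (1 / 36) ^+ k)) +
       2 * (6 * ((21 / 36) ^+ k + 5 * (3 / 36) ^+ k)) - 6 * ((16 / 36) ^+ k + 5 * (4 / 36) ^+ k)).
Proof.
transitivity (6 * \sum_(b < 6) (-1) ^+ b * Fpow k (umx (w ^+ b))).
  rewrite -(sixth_root_translate w2 wc (fun v => Fpow k (umx v))) /twist.
  apply: eq_bigr => a _; rewrite mul1r; apply: eq_bigr => b _.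
  by rewrite (biavg_Fpow z7) mulrAC.
congr (_ * _).
pose G s : Cx R := 6 * ((1 - 5 * s / 36) ^+ k + 5 * (s / 36) ^+ k).
rewrite (eq_bigr (fun b : 'I_6 => (-1) ^+ b * G (2 - w ^+ b - w^* ^+ b))) => [|b _].
  rewrite (alternating_sixth_sum w2 wc) /G.
  have -> : 1 - 5 * 0 / 36 = 1 :> Cx R by field.
  have -> : 0 / 36 = 0 :> Cx R by field.
  have -> : 1 - 5 * 1 / 36 = 31 / 36 :> Cx R by field.
  have -> : 1 - 5 * 3 / 36 = 21 / 36 :> Cx R by field.
  have -> : 1 - 5 * 4 / 36 = 16 / 36 :> Cx R by field.
  by rewrite expr1n.
rewrite Fpow_umx ?rmorphXn //= -exprMn (sixth_root_norm w2 wc) expr1n //.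
Qed.

Lemma twist_cst c : twist (fun=> c) = 0.
Proof.
rewrite /twist big1 // => a _; rewrite mul1r (eq_bigr (fun b : 'I_6 => (-1) ^+ a * c * (-1) ^+ b)) => [|b _].
  rewrite -mulr_sumr !big_ord_recl big_ord0 /= /bump /=.
  by rewrite !exprS expr0; ring.
by rewrite biavg_cst; ring.
Qed.

(** [f] is known to agree with a polynomial on the unitary group only, so the vanishing is stated
    for a polynomial representative [p]. *)
Lemma dual_certificate_eq0 f : poly_le 6 f ->
  exists2 p, (forall U, unitary U -> f U = p U) & dual_certificate p = 0.
Proof.
move=> /poly_le_polyf[r [r6 rE]].
exists (fun U => \sum_(q <- r) q.1 * mon q.2.1 q.2.2 U) => //.
have LP := dual_certificate_minv; have HP := hadamard_fouriermx w2 wc.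
have mP q : polyf (fun U : 'M[Cx R]_6 => q.1 * mon q.2.1 q.2.2 U).
  by apply: polyf_mul; [exact: polyf_cst|exact: polyf_mon].
rewrite (minv_sum LP) // big_seq big1 // => q /r6 q6.
rewrite (minv_scale LP); last exact: polyf_mon.
rewrite (minv_mon_eq0 z7 z1 LP _ _ _ q6) ?mulr0 // /dual_certificate.
- by rewrite !biavg_cst (cint_cst nuP) twist_cst; ring.
- rewrite !(biavg_Fpow z7) Fpow1 // (Fpow_hadamard 2 HP) twist_Fpow.
  by rewrite (cint_Fpow nuP (cint_sq2_6 nuP)); field.
- rewrite !(biavg_Fpow z7) Fpow1 // (Fpow_hadamard 3 HP) twist_Fpow.
  by rewrite (cint_Fpow nuP (cint_sq3_6 nuP)); field.
Qed.

Lemma biavg_ext (U : 'M[Cx R]_6) f g : unitary U -> (forall V, unitary V -> f V = g V) ->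
  biavg z U f = biavg z U g.
Proof.
move=> UU fg; rewrite /biavg; congr (_ * _); apply: eq_bigr => k _; apply: eq_bigr => l _.
exact/fg/unitary_kmx_conj.
Qed.

Lemma twist_ge0 f : pos_def_on_U f -> 0 <= twist f.
Proof.
(* The exponent 0 reduces [twist_unitary] to the family [umx (w ^+ a)]. *)
move=> fP; have := biavg_posdef z7 (fun a : 'I_6 => (-1) ^+ a) fP (fun a : 'I_6 => twist_unitary 0 a).
congr (_ <= _); apply: eq_bigr => a _; rewrite mul1r; apply: eq_bigr => b _.
rewrite !expr0 !mul1r adj_umx umxM rmorphXn /= rmorphXn rmorphN rmorph1 /=; ring.
Qed.

Lemma hadamard_kmx_conj (H : 'M[Cx R]_6) k l : hadamard H ->
  hadamard (kmx z k *m H *m adjmx (kmx z l)).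
Proof.
case=> HU HP; split; first exact: unitary_kmx_conj.
have zn : `|z| = 1 by apply/eqP; rewrite -(@pexpr_eq1 _ _ 2) // normCK (root7_norm z7).
by move=> i j; rewrite mul_kmxE kmx_mulE !normrM HP !normrX norm_conjC zn !expr1n !mul1r.
Qed.

Lemma biavg_hadamard_le0 (H : 'M[Cx R]_6) f : hadamard H ->
  (forall H, hadamard H -> f H <= 0) -> biavg z H f <= 0.
Proof.
move=> HP fH; rewrite /biavg pmulr_rle0; last first.
  by rewrite invr_gt0 exprn_gt0 // ltr0n kgroup_gt0.
by apply: sumr_le0 => k _; apply: sumr_le0 => l _; apply/fH/hadamard_kmx_conj.
Qed.

Lemma cint_admissible h : admissible 6 nu h -> cint nu h = 1.
Proof.
case=> _ _ hr _ h1; congr Complex.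
  by rewrite /Rintegral h1.
rewrite (@eq_Rintegral _ _ _ nu _ (fun=> 0)) ?Rintegral_cst ?mul0r //; first exact: measurable_unitary_set.
by move=> U; rewrite inE => UU; apply: complexI; rewrite RIm_real // hr.
Qed.

Lemma admissible_ge7 h : admissible 6 nu h -> 7 <= h 1%:M.
Proof.
move=> hA; have hi := cint_admissible hA; case: hA => hP h6 hr hH _.
have HP := hadamard_fouriermx w2 wc.
have [p hp] := dual_certificate_eq0 h6.
(* All terms of the certificate see unitary matrices only, so [p] may be replaced by [h], whose
   integral is 1. *)
rewrite /dual_certificate -(biavg_ext (@unitary1 R 6) hp) -(biavg_ext HP.1 hp) -(cint_ext _ hp) hi.
have -> : twist p = twist h.
  apply: eq_bigr => a _; congr (_ * _); apply: eq_bigr => b _; congr (_ * _).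
  by rewrite -(biavg_ext (twist_unitary a b) hp).
move=> e; apply: (le_trans _ (biavg1_le z7 hP)).
(* The vanishing certificate is solved for its first term; what is added to 7 is nonnegative. *)
have -> : biavg z 1%:M h = 7 + (6 * - biavg z (fouriermx w) h + 9 / 4 * twist h).
  apply/eqP; rewrite -subr_eq0 -[X in _ == X]e; apply/eqP.
  by move: (biavg _ _ _) (biavg _ _ _) (twist _) => A B T; ring.
rewrite lerDl addr_ge0 // mulr_ge0 ?twist_ge0 ?divr_ge0 ?ler0n //.
by rewrite oppr_ge0; exact: biavg_hadamard_le0.
Qed.

End LowerBound.

Theorem theorem1p10 (R : realType) (nu : probability (MatBorel R 6) R) :
  is_haar nu -> B_le 6 nu = 7%:R.
Proof.
move=> nuP.
have [z [z7 z1]] := seventh_root_exists R; have [w [w2 wc]] := sixth_root_exists R.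
have Re7 : complex.Re (7 : Cx R) = 7%:R by rewrite -[7 : Cx R](rmorph_nat (real_complex R)).
have lb : lbound [set complex.Re (h 1%:M) | h in admissible 6 nu] 7%:R.
  move=> _ [h hA <-]; have := admissible_ge7 nuP z7 z1 w2 wc hA.
  by rewrite lecE -Re7 => /andP[].
have mem : [set complex.Re (h 1%:M) | h in admissible 6 nu] 7%:R.
  by exists (@hopt R); [exact: admissible_hopt|rewrite hopt1].
(* 7 is both a lower bound and attained, which also gives the boundedness and nonemptiness that a
   meaningful [inf] requires. *)
rewrite /B_le; apply: le_anti; apply/andP; split.
  by apply: ge_inf mem; exists 7%:R.
by apply: lb_le_inf lb; exists 7%:R.
Qed.
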